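(* Let $\alpha\ge 1$, $\delta>0$, $0<\eta<1$, $\nu=\frac{1-\alpha}{2}$. Assume that: (i) there exist $u_0,v_0\in C^2[0,1]$ with $v_0\le u_0$ on $[0,1]$, where $$-(x^{\alpha}u_0'(x))'\ge x^{\alpha}f(x,u_0(x)),\ 0<x<1,\qquad u_0'(0)=0,\quad u_0(1)\ge\delta u_0(\eta),$$ $$-(x^{\alpha}v_0'(x))'\le x^{\alpha}f(x,v_0(x)),\ 0<x<1,\qquad v_0'(0)=0,\quad v_0(1)\le\delta v_0(\eta);$$ (ii) $f:D_2\to\mathbb{R}$ is continuous on $D_2=\{(x,y)\in[0,1]\times\mathbb{R}: v_0(x)\le y\le u_0(x)\}$; (iii) there exists $M_3\ge 0$ such that for all $(x,y),(x,w)\in D_2$ with $y\le w$, $f(x,w)-f(x,y)\ge -M_3(w-y)$; (iv) there exists a constant $\lambda<0$ such that $M_3+\lambda\le 0$, $K_{\nu}(\sqrt{|\lambda|})-\delta\eta^{\nu}K_{\nu}(\eta\sqrt{|\lambda|})\le 0$ and $I_{-\nu}(\sqrt{|\lambda|})-\delta\eta^{\nu}I_{-\nu}(\eta\sqrt{|\lambda|})>0$. Then the boundary value problem $$-(x^{\alpha}y'(x))'=x^{\alpha}f(x,y(x)),\ 0<x<1,\qquad y'(0)=0,\quad y(1)=\delta y(\eta)\qquad (\ast)$$ has at least one solution in the region $D_2$. The sequence $\{u_n\}$ generated by $$-y_{n+1}''(x)-\frac{\alpha}{x}y_{n+1}'(x)-\lambda y_{n+1}(x)=f(x,y_n(x))-\lambda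 y_n(x),\quad y_{n+1}'(0)=0,\quad y_{n+1}(1)=\delta y_{n+1}(\eta)$$ with initial iterate $y_0=u_0$ is monotonically non-increasing and converges uniformly to a solution $u$ of $(\ast)$. Similarly, with initial iterate $y_0=v_0$ the scheme gives a non-decreasing sequence $\{v_n\}$ converging to a solution $v$ of $(\ast)$. Any solution $z$ of $(\ast)$ in $D_2$ satisfies $v(x)\le z(x)\le u(x)$ for all $x\in[0,1]$.
   Context: $I_\mu$ and $K_\mu$ denote the modified Bessel functions of the first and second kind of order $\mu$. A solution is a function in $C[0,1]\cap C^2[0,1]$ satisfying the differential equation on $(0,1)$ and the boundary conditions; it is ''in the region $D_2$'' if $(x,y(x))\in D_2$ for all $x\in[0,1]$. *)

(* Defs.v *)
From Stdlib Require Import Reals Factorial.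
From Coquelicot Require Import Coquelicot.

Open Scope R_scope.

(* Reciprocal Gamma function, by Gauss's product
   1 / Gamma(s) = lim_n s (s+1) ... (s+n) / (n! n^s),
   valid for every real s (it vanishes at 0, -1, -2, and so on). *)
Definition rgamma (s : R) : R :=
  real (Lim_seq (fun n =>
    prod_f_R0 (fun i => s + INR i) n / (INR (fact n) * Rpower (INR n) s))).

(* I_mu(z) = sum_k (z/2)^(2k+mu) / (k! Gamma(k+mu+1)), for real mu and z > 0. *)
Definition besselI (mu z : R) : R :=
  Series (fun k =>
    Rpower (z / 2) (2 * INR k + mu) * rgamma (INR k + mu + 1) / INR (fact k)).

(* K_mu(z) = (pi/2) (I_{-mu}(z) - I_mu(z)) / sin(mu pi), extended by its limit
   to integer orders.  As the quotient is continuous in the order, taking the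
   (punctured) limit at every mu gives the same function. *)
Definition besselK (mu z : R) : R :=
  real (Lim (fun s => PI / 2 * (besselI (- s) z - besselI s z) / sin (s * PI)) mu).

Definition I01 (x : R) : Prop := 0 <= x <= 1.

(* Derivatives relative to [0,1], i.e. one-sided at the endpoints. *)
Definition C2_01 (y : R -> R) : Prop :=
  exists y1 y2 : R -> R,
    (forall x, I01 x -> D_in y y1 I01 x) /\
    (forall x, I01 x -> D_in y1 y2 I01 x) /\
    continuous_on I01 y2.

(* y'(0) = 0, with the right derivative at 0. *)
Definition flat_at_0 (y : R -> R) : Prop := D_in y (fun _ => 0) I01 0.

(* - (x^alpha y'(x))', used at interior points 0 < x < 1 only. *)
Definition Lop (alpha : R) (y : R -> R) (x : R) : R :=
  - Derive (fun t => Rpower t alpha * Derive y t) x.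

(* A function f : D2 -> R is represented by a total f : R * R -> R of which
   only the values on D2 matter. *)
Definition D2 (v0 u0 : R -> R) (p : R * R) : Prop :=
  I01 (fst p) /\ v0 (fst p) <= snd p <= u0 (fst p).

Definition in_region (v0 u0 y : R -> R) : Prop :=
  forall x, I01 x -> D2 v0 u0 (x, y x).

Definition is_solution (alpha delta eta : R) (f : R * R -> R) (y : R -> R) : Prop :=
  C2_01 y /\
  (forall x, 0 < x < 1 -> Lop alpha y x = Rpower x alpha * f (x, y x)) /\
  flat_at_0 y /\
  y 1 = delta * y eta.

(* z is an iterate following y. *)
Definition is_next (alpha delta eta lambda : R) (f : R * R -> R)
    (y z : R -> R) : Prop :=
  C2_01 z /\
  (forall x, 0 < x < 1 ->
     - Derive_n z 2 x - alpha / x * Derive z x - lambda * z x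
     = f (x, y x) - lambda * y x) /\
  flat_at_0 z /\
  z 1 = delta * z eta.

Definition is_iteration (alpha delta eta lambda : R) (f : R * R -> R)
    (y0 : R -> R) (s : nat -> R -> R) : Prop :=
  (forall x, I01 x -> s 0%nat x = y0 x) /\
  (forall n, is_next alpha delta eta lambda f (s n) (s (S n))).

(* s is the sequence generated by the scheme from y0: it stays in the region,
   so that the scheme makes sense at each step, and on [0,1] it is the only
   sequence satisfying the scheme. *)
Definition generated (alpha delta eta lambda : R) (f : R * R -> R)
    (v0 u0 y0 : R -> R) (s : nat -> R -> R) : Prop :=
  is_iteration alpha delta eta lambda f y0 s /\
  (forall n, in_region v0 u0 (s n)) /\
  (forall s', is_iteration alpha delta eta lambda f y0 s' ->
     forall n x, I01 x -> s' n x = s n x).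

Definition cvg_uniformly_01 (s : nat -> R -> R) (y : R -> R) : Prop :=
  forall eps, 0 < eps -> exists N : nat, forall n, (N <= n)%nat ->
    forall x, I01 x -> Rabs (s n x - y x) < eps.

(* Main.v *)
Require Import Defs.
From Stdlib Require Import Reals Factorial Lra Lia.
From Stdlib Require Import Classical IndefiniteDescription.
From Coquelicot Require Import Coquelicot.

Open Scope R_scope.

(** Write [F y x = f (x, y x) - lambda * y x].  Each step of the scheme solves
    the linear problem [H z = F y], where [H z = - z'' - alpha/x z' - lambda z],
    with a flat start at [0] and [z 1 = delta * z eta]; the solutions of the
    nonlinear problem are the fixed points of the step.  As
    [M3 + lambda <= 0], the one-sided Lipschitz condition makes [F] monotone in
    [y] on the region, so everything rests on two facts about the linear
    problem: it has a solution for every continuous right-hand side, and it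
    satisfies a comparison principle.

    Both come from one function.  Up to a nonnegative factor,
    [x^nu I_{-nu}(sqrt(-lambda) x)] is an even entire series [phi] with positive
    coefficients; it satisfies [H phi = 0], is positive and flat at [0], and
    the hypothesis on [I_{-nu}] says [delta * phi eta < phi 1]
    ([bessel_kernel], [bessel_boundary_sign]).

    Comparison: if [H y >= 0], the weighted Wronskian
    [x^alpha (phi y' - phi' y)] is nonincreasing and vanishes at [0], so it is
    nonpositive and [y / phi] is nonincreasing ([ratio_nonincreasing]).  Its
    minimum is at [1], where [y 1 >= delta * y eta] and
    [delta * phi eta < phi 1] force it to be nonnegative.

    Existence: the substitution [y = phi w] turns [H y = sigma] into
    [(x^alpha phi^2 w')' = - x^alpha phi sigma], which is integrated twice; the
    remaining additive constant in [w] is fixed by the condition at [1], whose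
    coefficient [phi 1 - delta * phi eta] is not zero ([linear_solvable]).

    Comparison keeps the iterates in the region and makes them monotone, so they
    converge pointwise.  Since [z'' + alpha/x z'] is bounded uniformly along the
    iteration, the iterates share a Lipschitz constant ([equi_lipschitz]) and
    the limit [u] is continuous.  Then [F] along the iterates converges
    monotonically to the continuous function [F u], hence uniformly by Dini's
    theorem, and comparison transfers uniform convergence to the solutions of
    the linear problems ([solves_linear_stable]).  Therefore [u] solves
    [H u = F u].  Finally, a solution [z] in the region is a fixed point of the
    monotone step, so it stays below all upper and above all lower iterates. *)

(** * Continuity and derivatives on the closed unit interval *)

(** The retraction onto [[0,1]].  Composing with it turns a function that is
    continuous relative to [[0,1]] into one that is continuous on the line, to
    which the two-sided theorems about continuity and integrals apply. *)
Definition clamp (x : R) : R := Rmax 0 (Rmin x 1).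

Lemma clamp_I01 x : I01 (clamp x).
Proof.
  unfold I01, clamp, Rmax, Rmin.
  destruct (Rle_dec x 1); destruct (Rle_dec 0 _); lra.
Qed.

Lemma clamp_id x : I01 x -> clamp x = x.
Proof.
  unfold I01, clamp, Rmax, Rmin. intros H.
  destruct (Rle_dec x 1); destruct (Rle_dec 0 _); lra.
Qed.

Lemma clamp_lipschitz x y : Rabs (clamp x - clamp y) <= Rabs (x - y).
Proof.
  unfold clamp, Rmax, Rmin, Rabs.
  repeat destruct Rle_dec; repeat destruct Rcase_abs; lra.
Qed.

Lemma continuous_on_I01_eps (g : R -> R) :
  continuous_on I01 g <->
  (forall x, I01 x -> forall eps, 0 < eps -> exists d, 0 < d /\
     forall t, I01 t -> Rabs (t - x) < d -> Rabs (g t - g x) < eps).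
Proof.
  split.
  - intros H x Hx eps Heps.
    specialize (H x Hx).
    apply filterlim_locally with (eps := mkposreal eps Heps) in H.
    destruct H as [d Hd]. exists d. split; [apply cond_pos|].
    intros t Ht Htx. exact (Hd t Htx Ht).
  - intros H x Hx. apply filterlim_locally. intros eps.
    destruct (H x Hx eps (cond_pos eps)) as [d [Hd Hd']].
    exists (mkposreal d Hd). intros t Htx Ht. exact (Hd' t Ht Htx).
Qed.

Lemma continuous_on_I01_clamp (g : R -> R) :
  continuous_on I01 g <-> (forall x, continuous (fun t => g (clamp t)) x).
Proof.
  rewrite continuous_on_I01_eps. split.
  - intros H x. apply filterlim_locally. intros eps.
    destruct (H (clamp x) (clamp_I01 x) eps (cond_pos eps)) as [d [Hd Hd']].
    exists (mkposreal d Hd). intros t Ht. apply Hd'.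
    + apply clamp_I01.
    + apply Rle_lt_trans with (1 := clamp_lipschitz _ _). exact Ht.
  - intros H x Hx eps Heps. specialize (H x).
    apply filterlim_locally with (eps := mkposreal eps Heps) in H.
    destruct H as [d Hd]. exists d. split; [apply cond_pos|].
    intros t Ht Htx. specialize (Hd t Htx).
    rewrite !clamp_id in Hd by assumption. exact Hd.
Qed.

Lemma continuous_on_I01_restrict (g : R -> R) :
  (forall x, continuous g x) -> continuous_on I01 g.
Proof. intros H. apply continuous_on_forall. intros x _. apply H. Qed.

Lemma continuous_on_I01_plus (g h : R -> R) :
  continuous_on I01 g -> continuous_on I01 h ->
  continuous_on I01 (fun x => g x + h x).
Proof.
  rewrite !continuous_on_I01_clamp. intros Hg Hh x.
  exact (continuous_plus _ _ x (Hg x) (Hh x)).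
Qed.

Lemma continuous_on_I01_mult (g h : R -> R) :
  continuous_on I01 g -> continuous_on I01 h ->
  continuous_on I01 (fun x => g x * h x).
Proof.
  rewrite !continuous_on_I01_clamp. intros Hg Hh x.
  exact (continuous_mult _ _ x (Hg x) (Hh x)).
Qed.

Lemma continuous_on_I01_scal (c : R) (g : R -> R) :
  continuous_on I01 g -> continuous_on I01 (fun x => c * g x).
Proof.
  intros Hg. apply (continuous_on_I01_mult (fun _ => c)); [|exact Hg].
  apply continuous_on_I01_restrict. intros x. apply continuous_const.
Qed.

Lemma continuous_on_I01_minus (g h : R -> R) :
  continuous_on I01 g -> continuous_on I01 h ->
  continuous_on I01 (fun x => g x - h x).
Proof.
  intros Hg Hh.
  apply (continuous_on_ext _ (fun x => g x + (-1) * h x)).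
  - intros x _. change (g x + (-1) * h x = g x - h x). ring.
  - apply continuous_on_I01_plus; [exact Hg|].
    now apply continuous_on_I01_scal.
Qed.

Lemma continuous_on_I01_inv (g : R -> R) :
  continuous_on I01 g -> (forall x, I01 x -> g x <> 0) ->
  continuous_on I01 (fun x => / g x).
Proof.
  rewrite !continuous_on_I01_clamp. intros Hg H0 x.
  apply continuous_Rinv_comp; [apply Hg|apply H0, clamp_I01].
Qed.

Lemma continuous_on_I01_bounded (g : R -> R) :
  continuous_on I01 g -> exists B, 0 <= B /\ forall x, I01 x -> Rabs (g x) <= B.
Proof.
  intros Hg. rewrite continuous_on_I01_clamp in Hg.
  assert (Hc : forall c, 0 <= c <= 1 ->
    continuity_pt (fun t => Rabs (g (clamp t))) c).
  { intros c _. apply continuity_pt_filterlim.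
    apply (continuous_comp (fun t => g (clamp t)) Rabs); [apply Hg|].
    apply continuous_Rabs. }
  destruct (continuity_ab_maj _ 0 1 Rle_0_1 Hc) as [m [Hm _]].
  exists (Rabs (g (clamp m))). split; [apply Rabs_pos|].
  intros x Hx. specialize (Hm x Hx). now rewrite (clamp_id x Hx) in Hm.
Qed.

Lemma locally_interior x : 0 < x < 1 -> locally x (fun t => 0 < t < 1).
Proof.
  intros Hx. apply (open_and (fun t => 0 < t) (fun t => t < 1)); auto.
  - apply open_gt.
  - apply open_lt.
Qed.

(** The mean value theorem applied to [g] composed with [clamp]: the endpoints
    then need only relative continuity. *)
Lemma nonincreasing_I01 (g dg : R -> R) :
  continuous_on I01 g ->
  (forall x, 0 < x < 1 -> is_derive g x (dg x)) ->
  (forall x, 0 < x < 1 -> dg x <= 0) ->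
  forall a b, 0 <= a -> a <= b -> b <= 1 -> g b <= g a.
Proof.
  intros Hg Hd Hneg a b Ha Hab Hb.
  destruct (Rle_lt_or_eq_dec a b Hab) as [Hlt| ->]; [|lra].
  rewrite continuous_on_I01_clamp in Hg.
  destruct (MVT_gen (fun t => g (clamp t)) a b
              (fun t => Rmin 0 (dg t))) as [c [Hc E]].
  - rewrite Rmin_left, Rmax_right by lra. intros x Hx.
    rewrite Rmin_right by (apply Hneg; lra).
    apply (is_derive_ext_loc g); [|apply Hd; lra].
    apply (filter_imp (fun t => 0 < t < 1)); [|apply locally_interior; lra].
    intros t Ht. rewrite clamp_id; [reflexivity|unfold I01; lra].
  - intros x _. apply continuity_pt_filterlim, Hg.
  - rewrite !clamp_id in E by (unfold I01; lra).
    pose proof (Rmin_l 0 (dg c)). nra.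
Qed.

Lemma D_in_interior (g g1 : R -> R) x :
  D_in g g1 I01 x -> 0 < x < 1 -> is_derive g x (g1 x).
Proof.
  intros H Hx. apply is_derive_Reals. intros eps Heps.
  destruct (H eps Heps) as [d [Hd Hd']].
  assert (Hm : 0 < Rmin d (Rmin x (1 - x))).
  { repeat apply Rmin_pos; lra. }
  exists (mkposreal _ Hm). simpl. intros h Hh0 Hh.
  assert (Hhd : Rabs h < d) by (eapply Rlt_le_trans; [exact Hh|apply Rmin_l]).
  assert (Hhx : Rabs h < x).
  { eapply Rlt_le_trans; [exact Hh|].
    eapply Rle_trans; [apply Rmin_r|apply Rmin_l]. }
  assert (Hhx1 : Rabs h < 1 - x).
  { eapply Rlt_le_trans; [exact Hh|].
    eapply Rle_trans; [apply Rmin_r|apply Rmin_r]. }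
  apply Rabs_def2 in Hhx. apply Rabs_def2 in Hhx1.
  specialize (Hd' (x + h)). simpl in Hd'. unfold Rdist in Hd'.
  replace (x + h - x) with h in Hd' by ring.
  apply Hd'. split; [|exact Hhd].
  split; [unfold I01; lra|lra].
Qed.

Lemma is_derive_D_in (g g1 : R -> R) x :
  is_derive g x (g1 x) -> D_in g g1 I01 x.
Proof.
  intros H. apply is_derive_Reals in H. intros eps Heps.
  destruct (H eps Heps) as [d Hd]. exists d. split; [apply cond_pos|].
  intros t [[_ Ht] Htd]. simpl in *. unfold Rdist in *.
  specialize (Hd (t - x)). replace (x + (t - x)) with t in Hd by ring.
  apply Hd; [lra|exact Htd].
Qed.

Lemma D_in_continuous (g g1 : R -> R) :
  (forall x, I01 x -> D_in g g1 I01 x) -> continuous_on I01 g.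
Proof.
  intros H. apply continuous_on_I01_eps. intros x Hx eps Heps.
  destruct (H x Hx 1 Rlt_0_1) as [d [Hd Hd']].
  pose (K := Rabs (g1 x) + 1).
  assert (HK : 0 < K) by (unfold K; pose proof (Rabs_pos (g1 x)); lra).
  exists (Rmin d (eps / K)). split.
  { apply Rmin_pos; [exact Hd|]. now apply Rdiv_lt_0_compat. }
  intros t Ht Htx.
  destruct (Req_dec t x) as [->|Hne].
  { rewrite Rminus_diag, Rabs_R0. exact Heps. }
  assert (H1 : Rabs ((g t - g x) / (t - x) - g1 x) < 1).
  { specialize (Hd' t). simpl in Hd'. unfold Rdist in Hd'. apply Hd'.
    split; [split; [exact Ht|lra]|].
    eapply Rlt_le_trans; [exact Htx|apply Rmin_l]. }
  assert (H2 : Rabs ((g t - g x) / (t - x)) < K).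
  { pose proof (Rabs_triang ((g t - g x) / (t - x) - g1 x) (g1 x)) as Ht3.
    replace ((g t - g x) / (t - x) - g1 x + g1 x)
      with ((g t - g x) / (t - x)) in Ht3 by ring.
    unfold K; lra. }
  replace (g t - g x) with ((g t - g x) / (t - x) * (t - x))
    by (field; lra).
  rewrite Rabs_mult.
  assert (H3 : Rabs (t - x) < eps / K)
    by (eapply Rlt_le_trans; [exact Htx|apply Rmin_r]).
  assert (H4 : 0 < Rabs (t - x)) by (apply Rabs_pos_lt; lra).
  replace eps with (K * (eps / K)) by (field; lra).
  apply Rmult_le_0_lt_compat; try assumption; apply Rabs_pos.
Qed.

Lemma D_in_scal_plus (a b : R) (g g1 h h1 : R -> R) x :
  D_in g g1 I01 x -> D_in h h1 I01 x ->
  D_in (fun t => a * g t + b * h t) (fun t => a * g1 t + b * h1 t) I01 x.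
Proof.
  intros Hg Hh. unfold D_in.
  apply (limit1_ext
    (fun t => a * ((g t - g x) / (t - x)) + b * ((h t - h x) / (t - x)))).
  - intros t [_ Ht]. field. lra.
  - apply limit_plus; (apply limit_mul; [|assumption]);
      (intros e He; exists 1; split; [lra|];
       intros t _; simpl; unfold Rdist; rewrite Rminus_diag, Rabs_R0; exact He).
Qed.

Lemma is_derive_continuous (g : R -> R) x l : is_derive g x l -> continuous g x.
Proof.
  intros H. apply (@ex_derive_continuous R_AbsRing R_NormedModule).
  now exists l.
Qed.

Lemma C2_01_continuous y : C2_01 y -> continuous_on I01 y.
Proof. intros (y1 & y2 & H & _). now apply D_in_continuous with y1. Qed.

Lemma C2_01_lincomb (a b : R) y z :
  C2_01 y -> C2_01 z -> C2_01 (fun x => a * y x + b * z x).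
Proof.
  intros (y1 & y2 & Hy & Hy1 & Hy2) (z1 & z2 & Hz & Hz1 & Hz2).
  exists (fun x => a * y1 x + b * z1 x), (fun x => a * y2 x + b * z2 x).
  split; [|split].
  - intros x Hx. apply D_in_scal_plus; auto.
  - intros x Hx. apply D_in_scal_plus; auto.
  - apply continuous_on_I01_plus; now apply continuous_on_I01_scal.
Qed.

Lemma C2_01_of_derive y y1 y2 :
  (forall x, I01 x -> is_derive y x (y1 x)) ->
  (forall x, I01 x -> is_derive y1 x (y2 x)) ->
  continuous_on I01 y2 -> C2_01 y.
Proof.
  intros H H1 H2. exists y1, y2. split; [|split; [|exact H2]];
  intros x Hx; apply is_derive_D_in; auto.
Qed.

(** * The singular Helmholtz operator *)

(** The left-hand side of the scheme.  Without the [lambda] term this is minus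
    the radial Laplacian in dimension [alpha + 1]; it is not meaningful at
    [x = 0]. *)
Definition helmholtz (alpha lambda : R) (z : R -> R) (x : R) : R :=
  - Derive_n z 2 x - alpha / x * Derive z x - lambda * z x.

Lemma Derive_n_2_interior y y1 y2 x :
  (forall x, 0 < x < 1 -> is_derive y x (y1 x)) ->
  (forall x, 0 < x < 1 -> is_derive y1 x (y2 x)) ->
  0 < x < 1 -> Derive y x = y1 x /\ Derive_n y 2 x = y2 x.
Proof.
  intros H H1 Hx. split; [now apply is_derive_unique, H|].
  simpl. rewrite (Derive_ext_loc _ y1); [now apply is_derive_unique, H1|].
  apply (filter_imp (fun t => 0 < t < 1)); [|now apply locally_interior].
  intros t Ht. now apply is_derive_unique, H.
Qed.

Lemma helmholtz_eq alpha lambda y y1 y2 x :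
  (forall x, 0 < x < 1 -> is_derive y x (y1 x)) ->
  (forall x, 0 < x < 1 -> is_derive y1 x (y2 x)) -> 0 < x < 1 ->
  helmholtz alpha lambda y x = - y2 x - alpha / x * y1 x - lambda * y x.
Proof.
  intros H H1 Hx. unfold helmholtz.
  destruct (Derive_n_2_interior y y1 y2 x H H1 Hx) as [-> ->]. reflexivity.
Qed.

(** The derivatives in [C2_01] are one-sided at the endpoints but agree with
    [Derive] inside, so one pair [y1], [y2] serves both readings; [y1] is
    moreover continuous up to [0], which is what the argument at the
    singularity relies on. *)
Lemma C2_01_helmholtz y : C2_01 y -> exists y1 y2,
  (forall x, 0 < x < 1 -> is_derive y x (y1 x)) /\
  (forall x, 0 < x < 1 -> is_derive y1 x (y2 x)) /\
  continuous_on I01 y1 /\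
  (forall alpha lambda x, 0 < x < 1 ->
     helmholtz alpha lambda y x = - y2 x - alpha / x * y1 x - lambda * y x).
Proof.
  intros (y1 & y2 & H & H1 & _). exists y1, y2.
  assert (A : forall x, 0 < x < 1 -> is_derive y x (y1 x)).
  { intros x Hx. apply D_in_interior; [apply H; unfold I01; lra|exact Hx]. }
  assert (B : forall x, 0 < x < 1 -> is_derive y1 x (y2 x)).
  { intros x Hx. apply D_in_interior; [apply H1; unfold I01; lra|exact Hx]. }
  split; [exact A|]. split; [exact B|]. split.
  - now apply D_in_continuous with y2.
  - intros alpha lambda x Hx. now apply helmholtz_eq.
Qed.

Lemma helmholtz_lincomb alpha lambda a b y z x :
  C2_01 y -> C2_01 z -> 0 < x < 1 ->
  helmholtz alpha lambda (fun t => a * y t + b * z t) x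
  = a * helmholtz alpha lambda y x + b * helmholtz alpha lambda z x.
Proof.
  intros Hy Hz Hx.
  destruct (C2_01_helmholtz y Hy) as (y1 & y2 & A & B & _ & E).
  destruct (C2_01_helmholtz z Hz) as (z1 & z2 & A' & B' & _ & E').
  rewrite E, E' by exact Hx.
  rewrite (helmholtz_eq alpha lambda _ (fun t => a * y1 t + b * z1 t)
             (fun t => a * y2 t + b * z2 t)); [ring| | |exact Hx].
  - intros t Ht. apply (is_derive_plus (fun t => a * y t) (fun t => b * z t));
      apply is_derive_scal; auto.
  - intros t Ht. apply (is_derive_plus (fun t => a * y1 t) (fun t => b * z1 t));
      apply is_derive_scal; auto.
Qed.

Lemma helmholtz_Lop alpha y x : C2_01 y -> 0 < x < 1 ->
  Lop alpha y x = Rpower x alpha * helmholtz alpha 0 y x.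
Proof.
  intros Hy Hx.
  destruct (C2_01_helmholtz y Hy) as (y1 & y2 & A & B & _ & ->); [|exact Hx].
  unfold Lop.
  rewrite (Derive_ext_loc _ (fun t => Rpower t alpha * y1 t)).
  2:{ apply (filter_imp (fun t => 0 < t < 1)); [|now apply locally_interior].
      intros t Ht. now rewrite (is_derive_unique _ _ _ (A t Ht)). }
  rewrite (is_derive_unique _ x
    (alpha * Rpower x (alpha - 1) * y1 x + Rpower x alpha * y2 x)).
  2:{ apply (is_derive_mult (fun t => Rpower t alpha) y1);
        [|apply B; exact Hx|intros; apply Rmult_comm].
      apply is_derive_Reals. apply derivable_pt_lim_power. lra. }
  unfold Rminus at 1. rewrite Rpower_plus, Rpower_Ropp, Rpower_1 by lra.
  field. lra.
Qed.

Lemma helmholtz_shift alpha lambda z x :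
  helmholtz alpha lambda z x = helmholtz alpha 0 z x - lambda * z x.
Proof. unfold helmholtz. ring. Qed.

(** * Comparison through the ratio with a positive kernel *)

(** The weight [x^alpha] with the value [0] at [0].  [Rpower 0 alpha] is [1],
    because [ln 0] is [0] by convention; the factor [x] repairs this and keeps
    the weight continuous at [0] when [1 <= alpha]. *)
Definition pow0 (alpha x : R) : R := x * Rpower x (alpha - 1).

Lemma pow0_pos alpha x : 0 < x -> 0 < pow0 alpha x.
Proof. intros H. apply Rmult_lt_0_compat; [exact H|apply exp_pos]. Qed.

Lemma pow0_0 alpha : pow0 alpha 0 = 0.
Proof. unfold pow0. ring. Qed.

Lemma pow0_Rpower alpha x : 0 < x -> pow0 alpha x = Rpower x alpha.
Proof.
  intros H. unfold pow0.
  rewrite <- (Rpower_1 x H) at 1. rewrite <- Rpower_plus. f_equal. ring.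
Qed.

Lemma is_derive_Rpower alpha x : 0 < x ->
  is_derive (fun t => Rpower t alpha) x (alpha * Rpower x (alpha - 1)).
Proof. intros H. apply is_derive_Reals. now apply derivable_pt_lim_power. Qed.

Lemma is_derive_pow0 alpha x : 0 < x ->
  is_derive (pow0 alpha) x (alpha * Rpower x (alpha - 1)).
Proof.
  intros H. apply (is_derive_ext_loc (fun t => Rpower t alpha)).
  - apply (filter_imp (fun t => 0 < t)); [|now apply open_gt].
    intros t Ht. symmetry. now apply pow0_Rpower.
  - now apply is_derive_Rpower.
Qed.

Lemma ln_nonpos x : x <= 1 -> ln x <= 0.
Proof.
  intros H. destruct (Rlt_le_dec 0 x) as [H0|H0].
  - rewrite <- ln_1.
    destruct (Rle_lt_or_eq_dec _ _ H) as [H1|H1]; [|rewrite H1; lra].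
    left. now apply ln_increasing.
  - unfold ln. destruct (Rlt_dec 0 x); [exfalso; lra|apply Rle_refl].
Qed.

Lemma continuous_pow0 alpha x : 1 <= alpha -> 0 <= x -> continuous (pow0 alpha) x.
Proof.
  intros Ha [Hx|<-].
  - eapply is_derive_continuous. now apply is_derive_pow0.
  - apply filterlim_locally. intros eps.
    assert (Hm : 0 < Rmin eps 1) by (apply Rmin_pos; [apply cond_pos|lra]).
    exists (mkposreal _ Hm). intros t Ht.
    change (Rabs (t - 0) < Rmin eps 1) in Ht.
    change (Rabs (pow0 alpha t - pow0 alpha 0) < eps).
    rewrite Rminus_0_r in Ht. rewrite pow0_0, Rminus_0_r. unfold pow0.
    rewrite Rabs_mult, (Rabs_pos_eq (Rpower _ _)) by (left; apply exp_pos).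
    assert (H1 : Rabs t < 1) by (eapply Rlt_le_trans; [exact Ht|apply Rmin_r]).
    assert (H2 : Rabs t < eps) by (eapply Rlt_le_trans; [exact Ht|apply Rmin_l]).
    assert (H3 : Rpower t (alpha - 1) <= 1).
    { assert (ln t <= 0) by (apply ln_nonpos; apply Rabs_def2 in H1; lra).
      unfold Rpower.
      destruct (Rle_lt_or_eq_dec ((alpha - 1) * ln t) 0) as [Hlt|Heq]; [nra| |].
      - apply exp_increasing in Hlt. rewrite exp_0 in Hlt. lra.
      - rewrite Heq, exp_0. lra. }
    pose proof (Rabs_pos t). pose proof (exp_pos ((alpha - 1) * ln t)).
    unfold Rpower in *. nra.
Qed.

(** A Sturm-type argument.  The weighted Wronskian
    [W = x^alpha (phi y' - phi' y)] satisfies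
    [W' = x^alpha (y * H phi - phi * H y) <= 0] for [H] the operator, and
    [W 0 = 0] because the weight kills the bounded factor.  Hence [W <= 0],
    and [(y / phi)' = W / (x^alpha phi^2)]. *)
Lemma ratio_nonincreasing alpha lambda phi y :
  1 <= alpha -> C2_01 phi -> C2_01 y ->
  (forall x, I01 x -> 0 < phi x) ->
  (forall x, 0 < x < 1 -> helmholtz alpha lambda phi x = 0) ->
  (forall x, 0 < x < 1 -> 0 <= helmholtz alpha lambda y x) ->
  forall a b, 0 <= a -> a <= b -> b <= 1 -> y b / phi b <= y a / phi a.
Proof.
  intros Ha Hphi Hy Hpos Ephi Hsup.
  destruct (C2_01_helmholtz phi Hphi) as (p1 & p2 & P1 & P2 & Cp1 & Ep).
  destruct (C2_01_helmholtz y Hy) as (y1 & y2 & Y1 & Y2 & Cy1 & Ey).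
  pose proof (C2_01_continuous _ Hphi) as Cp.
  pose proof (C2_01_continuous _ Hy) as Cy.
  set (W := fun x => pow0 alpha x * (phi x * y1 x - p1 x * y x)).
  assert (HW : forall x, 0 < x < 1 -> W x <= 0).
  { intros x Hx.
    replace 0 with (W 0) by (unfold W; rewrite pow0_0; ring).
    apply (nonincreasing_I01 W (fun x => pow0 alpha x *
      (y x * helmholtz alpha lambda phi x - phi x * helmholtz alpha lambda y x)));
      try lra.
    - apply continuous_on_I01_mult.
      + apply continuous_on_I01_eps. intros t Ht.
        intros eps Heps.
        assert (C := continuous_pow0 alpha t Ha (proj1 Ht)).
        apply filterlim_locally with (eps := mkposreal eps Heps) in C.
        destruct C as [d Hd]. exists d. split; [apply cond_pos|].
        intros s _ Hs. exact (Hd s Hs).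
      + apply continuous_on_I01_minus; now apply continuous_on_I01_mult.
    - intros t Ht.
      replace (pow0 alpha t * _) with
        (alpha * Rpower t (alpha - 1) * (phi t * y1 t - p1 t * y t) +
         pow0 alpha t * ((p1 t * y1 t + phi t * y2 t)
                         - (p2 t * y t + p1 t * y1 t))).
      2:{ rewrite Ep, Ey by exact Ht. unfold pow0. field. lra. }
      apply (is_derive_mult (pow0 alpha) (fun x => phi x * y1 x - p1 x * y x));
        [apply is_derive_pow0; lra| |intros; apply Rmult_comm].
      apply (is_derive_minus (fun x => phi x * y1 x) (fun x => p1 x * y x)).
      + apply (is_derive_mult phi y1); auto; intros; apply Rmult_comm.
      + apply (is_derive_mult p1 y); auto; intros; apply Rmult_comm.
    - intros t Ht. rewrite Ephi by exact Ht.
      pose proof (pow0_pos alpha t (proj1 Ht)).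
      assert (0 < phi t) by (apply Hpos; unfold I01; lra).
      specialize (Hsup t Ht).
      assert (0 <= phi t * helmholtz alpha lambda y t) by (apply Rmult_le_pos; lra).
      nra. }
  apply (nonincreasing_I01 (fun x => y x / phi x)
           (fun x => (y1 x * phi x - y x * p1 x) / phi x ^ 2)).
  - apply continuous_on_I01_mult; [exact Cy|].
    apply continuous_on_I01_inv; [exact Cp|].
    intros x Hx. specialize (Hpos x Hx). lra.
  - intros x Hx. assert (0 < phi x) by (apply Hpos; unfold I01; lra).
    apply (is_derive_div y phi); auto. lra.
  - intros x Hx. assert (Hp : 0 < phi x) by (apply Hpos; unfold I01; lra).
    specialize (HW x Hx). unfold W in HW.
    pose proof (pow0_pos alpha x (proj1 Hx)).
    assert (phi x * y1 x - p1 x * y x <= 0) by nra.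
    assert (0 < phi x ^ 2) by (apply pow_lt; exact Hp).
    apply Rmult_le_reg_r with (phi x ^ 2); [assumption|].
    unfold Rdiv. rewrite Rmult_assoc, Rinv_l by lra. lra.
Qed.

Definition comparison_principle (alpha delta eta lambda : R) : Prop :=
  forall y z, C2_01 y -> C2_01 z ->
    (forall x, 0 < x < 1 -> helmholtz alpha lambda y x <= helmholtz alpha lambda z x) ->
    y 1 <= delta * y eta -> z 1 >= delta * z eta ->
    forall x, I01 x -> y x <= z x.

(** The difference [w = z - y] has a nonincreasing ratio [w / phi], whose
    minimum is at [1].  Were it negative there, the boundary inequality would
    give [phi 1 * (w/phi) 1 >= delta * phi eta * (w/phi) 1], contradicting
    [delta * phi eta < phi 1]. *)
Lemma comparison_of_positive_kernel alpha delta eta lambda phi :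
  1 <= alpha -> 0 < delta -> 0 < eta < 1 ->
  C2_01 phi -> (forall x, I01 x -> 0 < phi x) ->
  (forall x, 0 < x < 1 -> helmholtz alpha lambda phi x = 0) ->
  delta * phi eta < phi 1 ->
  comparison_principle alpha delta eta lambda.
Proof.
  intros Ha Hd He Hphi Hpos Ephi Hbc y z Hy Hz Hyz By Bz x Hx.
  (* The coefficients [1] and [-1] put the difference in the form covered by
     the lemmas on linear combinations. *)
  set (w := fun t => 1 * z t + (-1) * y t).
  assert (Hw : C2_01 w) by now apply C2_01_lincomb.
  assert (Hmono := ratio_nonincreasing alpha lambda phi w Ha Hphi Hw Hpos Ephi).
  assert (Hsup : forall t, 0 < t < 1 -> 0 <= helmholtz alpha lambda w t).
  { intros t Ht. unfold w. rewrite helmholtz_lincomb by assumption.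
    specialize (Hyz t Ht). lra. }
  specialize (Hmono Hsup).
  assert (P : forall t, I01 t -> w t = w t / phi t * phi t).
  { intros t Ht. field. specialize (Hpos t Ht). lra. }
  assert (I1 : I01 1) by (unfold I01; lra).
  assert (Ie : I01 eta) by (unfold I01; lra).
  assert (Bw : w 1 >= delta * w eta) by (unfold w; lra).
  rewrite (P 1 I1), (P eta Ie) in Bw.
  pose proof (Hmono eta 1 ltac:(lra) ltac:(lra) ltac:(lra)) as M1.
  pose proof (Hmono x 1 (proj1 Hx) (proj2 Hx) ltac:(lra)) as Mx.
  pose proof (Hpos eta Ie) as Pe. pose proof (Hpos x Hx) as Px.
  set (w1 := w 1 / phi 1) in *. set (we := w eta / phi eta) in *.
  assert (W1 : 0 <= w1).
  { assert (w1 * (delta * phi eta) <= we * (delta * phi eta)).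
    { apply Rmult_le_compat_r; [|exact M1]. left.
      now apply Rmult_lt_0_compat. }
    nra. }
  assert (0 <= w x).
  { rewrite (P x Hx). apply Rmult_le_pos; lra. }
  unfold w in *. lra.
Qed.

(** A bound on [z'' + alpha/x z'] bounds the oscillation of [z].  The function
    [q = x^2 / (2 (alpha + 1))] satisfies [q'' + alpha/x q' = 1], so both
    [z - M q] and [- z - M q] are supersolutions of the operator with
    [lambda = 0], for which the constant [1] is a kernel; both are therefore
    nonincreasing, and [q] is itself [1]-Lipschitz. *)
Lemma equi_lipschitz alpha z M :
  1 <= alpha -> C2_01 z ->
  (forall x, 0 < x < 1 -> Rabs (helmholtz alpha 0 z x) <= M) ->
  forall a b, I01 a -> I01 b -> Rabs (z b - z a) <= M * Rabs (b - a).
Proof.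
  intros Ha Hz HM.
  set (q := fun x : R => x ^ 2 / (2 * (alpha + 1))).
  assert (Dq : forall x, is_derive q x (x / (alpha + 1))).
  { intros x. unfold q. auto_derive; [auto|field; lra]. }
  assert (Dq1 : forall x, is_derive (fun x => x / (alpha + 1)) x (/ (alpha + 1))).
  { intros x. auto_derive; [auto|field; lra]. }
  assert (Hq : C2_01 q).
  { apply C2_01_of_derive with (2 := fun x _ => Dq1 x); [intros; apply Dq|].
    apply continuous_on_I01_restrict. intros x. apply continuous_const. }
  assert (Eq : forall x, 0 < x < 1 -> helmholtz alpha 0 q x = -1).
  { intros x Hx. rewrite (helmholtz_eq alpha 0 q _ _ x (fun x _ => Dq x)
      (fun x _ => Dq1 x) Hx). field. lra. }
  set (one := fun _ : R => 1).
  assert (D1 : forall x, is_derive one x 0) by (intros x; apply @is_derive_const).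
  assert (D0 : forall x, is_derive (fun _ : R => 0) x 0)
    by (intros x; apply @is_derive_const).
  assert (H1 : C2_01 one).
  { apply C2_01_of_derive with (fun _ => 0) (fun _ => 0); auto.
    apply continuous_on_I01_restrict. intros x. apply continuous_const. }
  assert (E1 : forall x, 0 < x < 1 -> helmholtz alpha 0 one x = 0).
  { intros x Hx. rewrite (helmholtz_eq alpha 0 one _ _ x (fun x _ => D1 x)
      (fun x _ => D0 x) Hx). field. lra. }
  (* [s] is the sign of [z], so that one argument gives both bounds. *)
  assert (Hs : forall s, s = 1 \/ s = -1 ->
    forall a b, 0 <= a -> a <= b -> b <= 1 ->
      s * z b + - M * q b <= s * z a + - M * q a).
  { intros s Hsv a b H H' H''.
    pose proof (ratio_nonincreasing alpha 0 one (fun x => s * z x + - M * q x)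
      Ha H1 (C2_01_lincomb s (- M) z q Hz Hq) (fun _ _ => Rlt_0_1) E1) as R.
    assert (R' := fun K => R K a b H H' H'').
    cbv beta in R'. unfold one in R'. rewrite !Rdiv_1_r in R'.
    apply R'. intros x Hx.
    rewrite helmholtz_lincomb, Eq by assumption.
    specialize (HM x Hx).
    destruct Hsv as [-> | ->]; revert HM; unfold Rabs; destruct Rcase_abs; lra. }
  assert (M0 : 0 <= M).
  { specialize (HM (1/2) ltac:(lra)).
    pose proof (Rabs_pos (helmholtz alpha 0 z (1/2))). lra. }
  assert (Hle : forall a b, 0 <= a -> a <= b -> b <= 1 ->
    Rabs (z b - z a) <= M * (b - a)).
  { intros a b H H' H''.
    pose proof (Hs 1 (or_introl eq_refl) a b H H' H'') as S1.
    pose proof (Hs (-1) (or_intror eq_refl) a b H H' H'') as S2.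
    assert (Q : q b - q a <= b - a).
    { unfold q. apply Rmult_le_reg_r with (2 * (alpha + 1)); [lra|].
      replace ((b ^ 2 / (2 * (alpha + 1)) - a ^ 2 / (2 * (alpha + 1))) *
        (2 * (alpha + 1))) with ((b - a) * (b + a)) by (field; lra).
      nra. }
    assert (M * (q b - q a) <= M * (b - a)) by now apply Rmult_le_compat_l.
    apply Rabs_le. lra. }
  intros a b [A0 A1] [B0 B1]. destruct (Rle_dec a b) as [L|L].
  - rewrite (Rabs_pos_eq (b - a)) by lra. now apply Hle.
  - rewrite (Rabs_minus_sym (z b)), (Rabs_minus_sym b).
    rewrite (Rabs_pos_eq (a - b)) by lra. apply Hle; lra.
Qed.

(** * The regular Bessel kernel *)

(** From [ln y <= y - 1] at [y = (1 + s x) / (1 + x)] and at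
    [y = 1 / (1 + x)]. *)
Lemma bernoulli_Rpower x s : 0 <= x -> 1 <= s -> 1 + s * x <= Rpower (1 + x) s.
Proof.
  intros Hx Hs.
  assert (L : forall y, 0 < y -> ln y <= y - 1).
  { intros y Hy. pose proof (exp_ineq1_le (ln y)) as H.
    rewrite exp_ln in H by exact Hy. lra. }
  assert (P : 0 < 1 + s * x) by nra.
  assert (Q : 0 < 1 + x) by lra.
  rewrite <- (exp_ln (1 + s * x)) by exact P. unfold Rpower.
  assert (H : ln (1 + s * x) <= s * ln (1 + x)).
  { pose proof (L ((1 + s * x) / (1 + x))
      ltac:(now apply Rdiv_lt_0_compat)) as H1.
    pose proof (L (/ (1 + x)) ltac:(now apply Rinv_0_lt_compat)) as H2.
    rewrite ln_Rinv in H2 by exact Q.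
    rewrite ln_div in H1 by assumption.
    assert (E : (1 + s * x) / (1 + x) - 1 = (s - 1) * (1 - / (1 + x)))
      by (field; lra).
    rewrite E in H1. nra. }
  destruct H as [H|H]; [left; now apply exp_increasing|rewrite H; lra].
Qed.

(** The sequence whose limit defines [rgamma]. *)
Definition gauss_product (s : R) (n : nat) : R :=
  prod_f_R0 (fun i => s + INR i) n / (INR (fact n) * Rpower (INR n) s).

Lemma gauss_product_pos s n : 0 < s -> 0 < gauss_product s n.
Proof.
  intros Hs. unfold gauss_product. apply Rdiv_lt_0_compat.
  - induction n as [|n IH]; cbn [prod_f_R0].
    + simpl. lra.
    + apply Rmult_lt_0_compat; [exact IH|]. pose proof (pos_INR (S n)). lra.
  - apply Rmult_lt_0_compat; [apply INR_fact_lt_0|apply exp_pos].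
Qed.

(** This is what gives the limit a finite value: the quotient of consecutive
    terms is [(1 + s/(m+1)) * (m/(m+1))^s], which Bernoulli's inequality for the
    real exponent [s >= 1] bounds by [1]. *)
Lemma gauss_product_decreasing s n : 1 <= s ->
  gauss_product s (S (S n)) <= gauss_product s (S n).
Proof.
  intros Hs. remember (S n) as m eqn:Em.
  assert (Hm : 0 < INR m) by (subst m; apply lt_0_INR; lia).
  pose proof (gauss_product_pos s m ltac:(lra)) as Hg.
  assert (P : Rpower (INR m) s * (1 + s / INR m) <= Rpower (INR (S m)) s).
  { replace (INR (S m)) with (INR m * (1 + / INR m))
      by (rewrite S_INR; field; lra).
    assert (Hi : 0 < / INR m) by now apply Rinv_0_lt_compat.
    rewrite <- Rpower_mult_distr by lra.
    apply Rmult_le_compat_l; [left; apply exp_pos|].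
    apply bernoulli_Rpower; lra. }
  assert (E : gauss_product s (S m) = gauss_product s m *
    ((s + INR (S m)) / INR (S m) * (Rpower (INR m) s / Rpower (INR (S m)) s))).
  { unfold gauss_product. cbn [prod_f_R0]. rewrite fact_simpl, mult_INR.
    rewrite S_INR in *.
    field. repeat split; try lra; try apply Rgt_not_eq, exp_pos.
    apply INR_fact_neq_0. }
  rewrite E. rewrite <- (Rmult_1_r (gauss_product s m)) at 2.
  apply Rmult_le_compat_l; [lra|].
  assert (0 < Rpower (INR (S m)) s) by apply exp_pos.
  assert (0 < Rpower (INR m) s) by apply exp_pos.
  assert (Q : (s + INR (S m)) / INR (S m) <= 1 + s / INR m).
  { rewrite S_INR.
    assert (0 <= s * (/ INR m - / (INR m + 1))).
    { apply Rmult_le_pos; [lra|].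
      assert (/ (INR m + 1) <= / INR m) by (apply Rinv_le_contravar; lra). lra. }
    replace ((s + (INR m + 1)) / (INR m + 1)) with (1 + s * / (INR m + 1))
      by (field; lra).
    unfold Rdiv. lra. }
  apply Rmult_le_reg_r with (Rpower (INR (S m)) s); [assumption|].
  replace (_ * Rpower (INR (S m)) s) with
    (Rpower (INR m) s * ((s + INR (S m)) / INR (S m))) by
    (field; split; [lra|rewrite S_INR; lra]).
  nra.
Qed.

Lemma gauss_product_cv s : 1 <= s ->
  is_lim_seq (gauss_product s) (rgamma s) /\ 0 <= rgamma s.
Proof.
  intros Hs.
  assert (H : ex_finite_lim_seq (gauss_product s)).
  { destruct (ex_finite_lim_seq_decr (fun n => gauss_product s (S n)) 0) as [l Hl].
    - intros n. now apply gauss_product_decreasing.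
    - intros n. left. apply gauss_product_pos. lra.
    - exists l. now apply is_lim_seq_incr_1. }
  assert (L : is_lim_seq (gauss_product s) (rgamma s)) by now apply Lim_seq_correct'.
  split; [exact L|].
  apply (is_lim_seq_le (fun _ => 0) (gauss_product s) 0 (rgamma s)); auto.
  - intros n. left. apply gauss_product_pos. lra.
  - apply is_lim_seq_const.
Qed.

(** The functional equation of Gamma.  On Gauss's sequence it holds up to the
    factor [(s + 1 + n) / n], which tends to [1]. *)
Lemma rgamma_succ s : 1 <= s -> s * rgamma (s + 1) = rgamma s.
Proof.
  intros Hs.
  destruct (gauss_product_cv s Hs) as [L _].
  destruct (gauss_product_cv (s + 1) ltac:(lra)) as [L' _].
  apply (is_lim_seq_scal_l _ s) in L'. simpl in L'.
  assert (F : is_lim_seq (fun n => 1 + (s + 1) * / INR n) (1 + (s + 1) * 0)).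
  { apply is_lim_seq_plus'; [apply is_lim_seq_const|].
    apply (is_lim_seq_scal_l _ (s + 1) 0).
    replace (Finite 0) with (Rbar_inv p_infty) by reflexivity.
    apply is_lim_seq_inv; [apply is_lim_seq_INR|discriminate]. }
  pose proof (is_lim_seq_mult' _ _ _ _ L F) as L2.
  apply is_lim_seq_unique in L'.
  apply (is_lim_seq_ext_loc _ (fun n => s * gauss_product (s + 1) n)) in L2.
  - apply is_lim_seq_unique in L2. rewrite L' in L2.
    injection L2 as L2. rewrite L2. ring.
  - exists 1%nat. intros n Hn.
    assert (0 < INR n) by (apply lt_0_INR; lia).
    assert (P : s * prod_f_R0 (fun i => s + 1 + INR i) n =
      prod_f_R0 (fun i => s + INR i) n * (s + 1 + INR n)).
    { clear. induction n as [|n IH]; cbn [prod_f_R0]; [simpl; ring|].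
      rewrite <- Rmult_assoc, IH, S_INR. ring. }
    unfold gauss_product. unfold Rdiv. rewrite <- (Rmult_assoc s), P.
    rewrite Rpower_plus, Rpower_1 by assumption.
    field. repeat split; try lra; try apply Rgt_not_eq, exp_pos.
    apply INR_fact_neq_0.
Qed.

(** Coefficients of [sum_k t^k / (k! (mu+1)(mu+2)...(mu+k))]: at [t = (z/2)^2]
    this is [I_mu(z)] without the factor [(z/2)^mu / Gamma(mu+1)]. *)
Fixpoint bessel_coef (mu : R) (k : nat) : R :=
  match k with
  | O => 1
  | S j => bessel_coef mu j / ((INR j + 1) * (INR j + mu + 1))
  end.

Lemma bessel_coef_pos mu k : 0 <= mu -> 0 < bessel_coef mu k.
Proof.
  intros H. induction k as [|k IH]; simpl bessel_coef; [lra|].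
  pose proof (pos_INR k).
  apply Rdiv_lt_0_compat; [exact IH|]. apply Rmult_lt_0_compat; lra.
Qed.

Lemma bessel_coef_radius mu : 0 <= mu -> CV_radius (bessel_coef mu) = p_infty.
Proof.
  intros H. apply CV_radius_infinite_DAlembert.
  - intros n. apply Rgt_not_eq. now apply bessel_coef_pos.
  - apply (is_lim_seq_le_le (fun _ => 0) _ (fun n => / (INR n + 1))).
    + intros n. split; [apply Rabs_pos|].
      pose proof (bessel_coef_pos mu n H). pose proof (pos_INR n).
      simpl bessel_coef.
      replace
        (bessel_coef mu n / ((INR n + 1) * (INR n + mu + 1)) / bessel_coef mu n)
        with (/ (INR n + 1) * / (INR n + mu + 1)) by (field; lra).
      assert (0 < / (INR n + 1)) by (apply Rinv_0_lt_compat; lra).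
      assert (0 < / (INR n + mu + 1)) by (apply Rinv_0_lt_compat; lra).
      assert (/ (INR n + mu + 1) <= 1).
      { rewrite <- Rinv_1. apply Rinv_le_contravar; lra. }
      rewrite Rabs_pos_eq by nra. nra.
    + apply is_lim_seq_const.
    + apply (is_lim_seq_ext (fun n => / INR (S n))).
      { intros n. now rewrite S_INR. }
      apply (is_lim_seq_incr_1 (fun n => / INR n)).
      replace (Finite 0) with (Rbar_inv p_infty) by reflexivity.
      apply is_lim_seq_inv; [apply is_lim_seq_INR|discriminate].
Qed.

Lemma besselI_PSeries mu z : 0 <= mu -> 0 < z ->
  besselI mu z
  = Rpower (z / 2) mu * rgamma (mu + 1) * PSeries (bessel_coef mu) ((z / 2) ^ 2).
Proof.
  intros Hmu Hz. unfold besselI, PSeries. rewrite <- Series_scal_l.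
  apply Series_ext. intros k.
  assert (E : rgamma (INR k + mu + 1) / INR (fact k)
              = rgamma (mu + 1) * bessel_coef mu k).
  { induction k as [|k IH].
    - simpl. rewrite Rplus_0_l. field.
    - simpl bessel_coef. pose proof (pos_INR k).
      replace (INR (S k) + mu + 1) with (INR k + mu + 1 + 1)
        by (rewrite S_INR; ring).
      rewrite fact_simpl, mult_INR, S_INR.
      assert (Hs := rgamma_succ (INR k + mu + 1) ltac:(lra)).
      rewrite <- Hs in IH.
      unfold Rdiv at 2. rewrite <- Rmult_assoc, <- IH.
      field. repeat split; try lra. apply INR_fact_neq_0. }
  unfold Rdiv at 1. rewrite Rmult_assoc.
  change (Rpower (z / 2) (2 * INR k + mu) *
    (rgamma (INR k + mu + 1) / INR (fact k)) =
    Rpower (z / 2) mu * rgamma (mu + 1) * (bessel_coef mu k * ((z / 2) ^ 2) ^ k)).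
  rewrite E, Rpower_plus, <- pow_mult.
  replace (2 * INR k) with (INR (2 * k)) by (rewrite mult_INR; reflexivity).
  rewrite Rpower_pow by lra. ring.
Qed.

Lemma is_derive_PSeries_entire a t : CV_radius a = p_infty ->
  is_derive (PSeries a) t (PSeries (PS_derive a) t).
Proof. intros H. apply is_derive_PSeries. now rewrite H. Qed.

Lemma ex_pseries_entire (a : nat -> R) (t : R) :
  CV_radius a = p_infty -> ex_pseries a t.
Proof. intros H. apply CV_radius_inside. now rewrite H. Qed.

(** Bessel's equation in the variable [t = (z/2)^2].  It is the recursion
    defining the coefficients, read off degree by degree. *)
Lemma bessel_coef_ode mu t : 0 <= mu ->
  t * PSeries (PS_derive (PS_derive (bessel_coef mu))) t
  + (mu + 1) * PSeries (PS_derive (bessel_coef mu)) t = PSeries (bessel_coef mu) t.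
Proof.
  intros H. pose proof (bessel_coef_radius mu H) as Hr.
  assert (Hr1 : CV_radius (PS_derive (bessel_coef mu)) = p_infty)
    by (now rewrite CV_radius_derive).
  assert (Hr2 : CV_radius (PS_derive (PS_derive (bessel_coef mu))) = p_infty)
    by (now rewrite CV_radius_derive).
  rewrite <- PSeries_incr_1, <- PSeries_scal, <- PSeries_plus.
  - apply PSeries_ext. intros [|n].
    + unfold PS_plus, PS_scal, PS_incr_1, PS_derive.
      simpl. change (0 + (mu + 1) * (1 * (1 / ((0 + 1) * (0 + mu + 1)))) = 1).
      field. lra.
    + unfold PS_plus, PS_scal, PS_incr_1, PS_derive.
      change (INR (S n) * (INR (S (S n)) * bessel_coef mu (S (S n))) +
        (mu + 1) * (INR (S (S n)) * bessel_coef mu (S (S n))) = bessel_coef mu (S n)).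
      change (bessel_coef mu (S (S n))) with
        (bessel_coef mu (S n) / ((INR (S n) + 1) * (INR (S n) + mu + 1))).
      pose proof (pos_INR n). rewrite !S_INR. field. lra.
  - apply ex_pseries_incr_1, ex_pseries_entire, Hr2.
  - apply ex_pseries_scal; [apply Rmult_comm|]. apply ex_pseries_entire, Hr1.
Qed.

(** The derivatives are two-sided on the whole line, so that products and
    quotients with [phi] need no care at the endpoints. *)
Definition regular_kernel (alpha lambda : R) (phi phi1 phi2 : R -> R) : Prop :=
  (forall x, is_derive phi x (phi1 x)) /\
  (forall x, is_derive phi1 x (phi2 x)) /\
  (forall x, continuous phi2 x) /\
  (forall x, 0 < phi x) /\
  phi1 0 = 0 /\
  (forall x, x <> 0 -> phi2 x + alpha / x * phi1 x = - lambda * phi x).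

(** The kernel is an entire series in [x^2], hence smooth and flat at the
    singular point; it is at least [1] since its coefficients are positive and
    the first one is [1]. *)
Lemma bessel_kernel alpha lambda :
  1 <= alpha -> lambda < 0 ->
  exists phi1 phi2, regular_kernel alpha lambda
    (fun x => PSeries (bessel_coef ((alpha - 1) / 2)) (- lambda / 4 * x ^ 2))
    phi1 phi2.
Proof.
  intros Ha Hl. set (mu := (alpha - 1) / 2). set (m := - lambda / 4).
  assert (Hmu : 0 <= mu) by (unfold mu; lra).
  assert (Hm : 0 < m) by (unfold m; lra).
  pose proof (bessel_coef_radius mu Hmu) as Hr0.
  set (a0 := bessel_coef mu) in *. set (a1 := PS_derive a0). set (a2 := PS_derive a1).
  assert (Hr1 : CV_radius a1 = p_infty) by (unfold a1; now rewrite CV_radius_derive).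
  assert (Hr2 : CV_radius a2 = p_infty) by (unfold a2; now rewrite CV_radius_derive).
  assert (D : forall a x, CV_radius a = p_infty ->
    is_derive (fun t => PSeries a (m * t ^ 2)) x
      (2 * m * x * PSeries (PS_derive a) (m * x ^ 2))).
  { intros a x Hr.
    apply (is_derive_comp (PSeries a) (fun t => m * t ^ 2)).
    - now apply is_derive_PSeries_entire.
    - auto_derive; [auto|ring]. }
  exists (fun x => 2 * m * x * PSeries a1 (m * x ^ 2)).
  exists (fun x => 2 * m * PSeries a1 (m * x ^ 2) +
     2 * m * x * (2 * m * x * PSeries a2 (m * x ^ 2))).
  assert (C : forall a x, CV_radius a = p_infty ->
    continuous (fun t => PSeries a (m * t ^ 2)) x).
  { intros a x Hr. eapply is_derive_continuous. now apply D. }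
  assert (Cx : forall x, continuous (fun t => 2 * m * t) x).
  { intros x. apply (continuous_mult (fun _ => 2 * m) (fun t => t)).
    - apply continuous_const.
    - apply continuous_id. }
  split; [|split; [|split; [|split; [|split]]]].
  - intros x. now apply D.
  - intros x.
    apply (is_derive_mult (fun x => 2 * m * x)
             (fun x => PSeries a1 (m * x ^ 2))).
    + auto_derive; [auto|ring].
    + now apply D.
    + intros. apply Rmult_comm.
  - intros x.
    apply (continuous_plus (fun x => 2 * m * PSeries a1 (m * x ^ 2))
      (fun x => 2 * m * x * (2 * m * x * PSeries a2 (m * x ^ 2)))).
    + apply (continuous_mult (fun _ => 2 * m)); [apply continuous_const|].
      now apply C.
    + apply (continuous_mult (fun x => 2 * m * x)); [apply Cx|].
      apply (continuous_mult (fun x => 2 * m * x)); [apply Cx|]. now apply C.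
  - intros x. apply Rlt_le_trans with 1; [lra|].
    unfold PSeries.
    assert (E : ex_series (fun k => a0 k * (m * x ^ 2) ^ k)).
    { apply ex_pseries_R, ex_pseries_entire, Hr0. }
    assert (Hx : 0 <= m * x ^ 2).
    { apply Rmult_le_pos; [lra|apply pow2_ge_0]. }
    rewrite Series_incr_1 by exact E. simpl (_ ^ 0).
    change (a0 0%nat) with 1.
    apply (ex_series_incr_1 (fun k => a0 k * (m * x ^ 2) ^ k)) in E.
    assert (S0 : 0 <= Series (fun k => a0 (S k) * (m * x ^ 2) ^ (S k))).
    { replace 0 with (Series (fun _ => 0)).
      - apply Series_le; [|exact E]. intros n. split; [lra|].
        apply Rmult_le_pos; [left; now apply bessel_coef_pos|now apply pow_le].
      - transitivity (0 * Series (fun _ => 0)); [|ring].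
        rewrite <- Series_scal_l. apply Series_ext. intros n. ring. }
    lra.
  - ring.
  - intros x Hx.
    pose proof (bessel_coef_ode mu (m * x ^ 2) Hmu) as E.
    change (m * x ^ 2 * PSeries a2 (m * x ^ 2) +
            (mu + 1) * PSeries a1 (m * x ^ 2) = PSeries a0 (m * x ^ 2)) in E.
    replace (- lambda) with (4 * m) by (unfold m; field).
    replace alpha with (2 * mu + 1) by (unfold mu; field).
    fold mu. fold a0. rewrite <- E. field. exact Hx.
Qed.

(** The hypothesis on [I_{-nu}] is
    [(kappa/2)^(-nu) / Gamma(1-nu) * (phi 1 - delta * phi eta) > 0] with
    [kappa = sqrt(-lambda)], because [eta^nu] cancels the power of [eta]
    in [I_{-nu}(eta kappa)].  The prefactor is nonnegative, as a limit of
    positive terms, and this decides the sign of the other factor. *)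
Lemma bessel_boundary_sign alpha delta eta nu lambda :
  1 <= alpha -> 0 < eta < 1 -> nu = (1 - alpha) / 2 -> lambda < 0 ->
  besselI (- nu) (sqrt (Rabs lambda))
  - delta * Rpower eta nu * besselI (- nu) (eta * sqrt (Rabs lambda)) > 0 ->
  delta * PSeries (bessel_coef ((alpha - 1) / 2)) (- lambda / 4 * eta ^ 2)
  < PSeries (bessel_coef ((alpha - 1) / 2)) (- lambda / 4 * 1 ^ 2).
Proof.
  intros Ha He Hnu Hl H.
  replace ((alpha - 1) / 2) with (- nu) by (rewrite Hnu; field).
  assert (Hmu : 0 <= - nu) by (rewrite Hnu; lra).
  set (mu := - nu) in *. set (kappa := sqrt (Rabs lambda)) in *.
  assert (Hk : 0 < kappa).
  { apply sqrt_lt_R0, Rabs_pos_lt. lra. }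
  assert (Hk2 : kappa ^ 2 = - lambda).
  { unfold kappa. rewrite pow2_sqrt by apply Rabs_pos.
    apply Rabs_left. lra. }
  rewrite !besselI_PSeries in H by nra.
  replace ((kappa / 2) ^ 2) with (- lambda / 4 * 1 ^ 2) in H
    by (rewrite <- Hk2; field).
  replace ((eta * kappa / 2) ^ 2) with (- lambda / 4 * eta ^ 2) in H
    by (rewrite <- Hk2; field).
  replace (eta * kappa / 2) with (eta * (kappa / 2)) in H by field.
  rewrite <- Rpower_mult_distr in H by lra.
  set (p1 := PSeries _ (_ * 1 ^ 2)) in *. set (pe := PSeries _ (_ * eta ^ 2)) in *.
  assert (Hee : Rpower eta nu * Rpower eta mu = 1).
  { unfold mu. rewrite <- Rpower_plus, Rplus_opp_r. apply Rpower_O. lra. }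
  assert (Hg : 0 <= rgamma (mu + 1)) by (apply gauss_product_cv; lra).
  assert (Hp : 0 < Rpower (kappa / 2) mu) by apply exp_pos.
  assert (E : Rpower (kappa / 2) mu * rgamma (mu + 1) * (p1 - delta * pe) > 0).
  { replace (delta * pe) with (delta * (Rpower eta nu * Rpower eta mu) * pe)
      by (rewrite Hee; ring).
    match goal with |- ?g > 0 => match type of H with ?h > 0 =>
      replace g with h by ring end end. exact H. }
  assert (Hc : 0 <= Rpower (kappa / 2) mu * rgamma (mu + 1)) by nra.
  nra.
Qed.

(** * Solvability of the linear problem *)

(** The rescaled form of [x^(-alpha-1) * int_0^x t^alpha r(t) dt]: with the
    interval of integration fixed, it is visibly continuous through [x = 0]. *)
Definition weighted_mean (alpha : R) (r : R -> R) (x : R) : R :=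
  RInt (fun s => pow0 alpha s * r (x * s)) 0 1.

Lemma continuous_linear c x : continuous (fun s => c * s) x.
Proof.
  apply (continuous_mult (fun _ => c) (fun s => s)).
  - apply continuous_const.
  - apply continuous_id.
Qed.

Lemma ex_RInt_pow0_mult alpha r b : 1 <= alpha -> 0 <= b ->
  (forall x, continuous r x) -> ex_RInt (fun s => pow0 alpha s * r s) 0 b.
Proof.
  intros Ha Hb Hr. apply (@ex_RInt_continuous R_CompleteNormedModule).
  rewrite Rmin_left by exact Hb. intros s [Hs _].
  apply (continuous_mult (pow0 alpha) r); [now apply continuous_pow0|apply Hr].
Qed.

Lemma ex_RInt_weighted_mean alpha r x : 1 <= alpha ->
  (forall x, continuous r x) -> ex_RInt (fun s => pow0 alpha s * r (x * s)) 0 1.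
Proof.
  intros Ha Hr.
  apply (ex_RInt_pow0_mult alpha (fun s => r (x * s))); [exact Ha|lra|].
  intros s. apply (continuous_comp (fun s => x * s) r); [|apply Hr].
  apply continuous_linear.
Qed.

(** Continuity under the integral sign, by uniform continuity of the integrand
    on the rectangle [[x-1,x+1] * [0,1]]. *)
Lemma continuous_weighted_mean alpha r : 1 <= alpha ->
  (forall x, continuous r x) -> forall x, continuous (weighted_mean alpha r) x.
Proof.
  intros Ha Hr x. apply filterlim_locally. intros eps.
  destruct (uniform_continuity_2d (fun u s => pow0 alpha s * r (u * s))
    (x - 1) (x + 1) 0 1) with (eps := pos_div_2 eps) as [d Hd].
  { intros u s _ [Hs _]. apply continuity_2d_pt_mult.
    - apply (continuity_1d_2d_pt_comp (pow0 alpha) (fun _ v => v)).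
      + apply continuity_pt_filterlim. now apply continuous_pow0.
      + apply continuity_2d_pt_id2.
    - apply (continuity_1d_2d_pt_comp r (fun u v => u * v)).
      + apply continuity_pt_filterlim, Hr.
      + apply continuity_2d_pt_mult;
          [apply continuity_2d_pt_id1|apply continuity_2d_pt_id2]. }
  exists (mkposreal _ (Rmin_pos _ _ (cond_pos d) Rlt_0_1)). intros t Ht.
  change (Rabs (t - x) < Rmin d 1) in Ht.
  assert (H1 : Rabs (t - x) < 1) by (eapply Rlt_le_trans; [exact Ht|apply Rmin_r]).
  assert (H2 : Rabs (t - x) < d) by (eapply Rlt_le_trans; [exact Ht|apply Rmin_l]).
  apply Rabs_def2 in H1.
  change (Rabs (weighted_mean alpha r t - weighted_mean alpha r x) < eps).
  pose proof (ex_RInt_weighted_mean alpha r t Ha Hr) as It.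
  pose proof (ex_RInt_weighted_mean alpha r x Ha Hr) as Ix.
  unfold weighted_mean.
  change (Rabs (minus (RInt (fun s => pow0 alpha s * r (t * s)) 0 1)
    (RInt (fun s => pow0 alpha s * r (x * s)) 0 1)) < eps).
  rewrite <- RInt_minus by assumption.
  apply Rle_lt_trans with ((1 - 0) * (eps / 2)).
  - apply abs_RInt_le_const; [lra| |].
    + now apply (@ex_RInt_minus R_NormedModule).
    + intros s Hs. left.
      apply (Hd x s t s); try lra; try exact H2.
      rewrite Rminus_diag, Rabs_R0. apply cond_pos.
  - pose proof (cond_pos eps). lra.
Qed.

Lemma is_derive_id_mult_0 (g : R -> R) :
  continuous g 0 -> is_derive (fun x => x * g x) 0 (g 0).
Proof.
  intros Hg. apply is_derive_Reals. intros eps Heps.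
  apply filterlim_locally with (eps := mkposreal eps Heps) in Hg.
  destruct Hg as [d Hd]. exists d. intros h Hh0 Hh.
  replace (((0 + h) * g (0 + h) - 0 * g 0) / h) with (g h)
    by (rewrite Rplus_0_l; field; exact Hh0).
  apply Hd. change (Rabs (h - 0) < d). now rewrite Rminus_0_r.
Qed.

Lemma RInt_pow0 alpha : 1 <= alpha -> RInt (pow0 alpha) 0 1 = / (alpha + 1).
Proof.
  intros Ha.
  assert (H : is_RInt (pow0 alpha) 0 1
    (minus (/ (alpha + 1) * (1 * pow0 alpha 1))
           (/ (alpha + 1) * (0 * pow0 alpha 0)))).
  { apply (is_RInt_derive (fun x => / (alpha + 1) * (x * pow0 alpha x))).
    - rewrite Rmin_left by lra. intros x [[Hx|<-] _].
      + replace (pow0 alpha x) with (/ (alpha + 1) *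
          (1 * pow0 alpha x + x * (alpha * Rpower x (alpha - 1))))
          by (unfold pow0; field; lra).
        apply is_derive_scal.
        apply (is_derive_mult (fun x => x) (pow0 alpha)).
        * apply @is_derive_id.
        * now apply is_derive_pow0.
        * intros. apply Rmult_comm.
      + replace (pow0 alpha 0) with (/ (alpha + 1) * pow0 alpha 0)
          by (rewrite pow0_0; ring).
        apply is_derive_scal, is_derive_id_mult_0.
        apply continuous_pow0; lra.
    - rewrite Rmin_left by lra. intros x [Hx _]. now apply continuous_pow0. }
  apply (@is_RInt_unique R_CompleteNormedModule) in H. rewrite H, pow0_Rpower by lra.
  unfold Rpower. rewrite ln_1, Rmult_0_r, exp_0.
  change (/ (alpha + 1) * (1 * 1) + - (/ (alpha + 1) * (0 * pow0 alpha 0))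
    = / (alpha + 1)). ring.
Qed.

Lemma weighted_mean_0 alpha r : 1 <= alpha ->
  weighted_mean alpha r 0 = r 0 / (alpha + 1).
Proof.
  intros Ha. unfold weighted_mean.
  rewrite (RInt_ext _ (fun s => scal (r 0) (pow0 alpha s))).
  - rewrite (@RInt_scal R_CompleteNormedModule).
    + rewrite RInt_pow0 by exact Ha. reflexivity.
    + apply (@ex_RInt_continuous R_CompleteNormedModule).
      rewrite Rmin_left by lra. intros s [Hs _]. now apply continuous_pow0.
  - intros s _. rewrite Rmult_0_l. apply Rmult_comm.
Qed.

Lemma weighted_mean_scaling alpha r x : 1 <= alpha -> 0 < x ->
  (forall x, continuous r x) ->
  x * weighted_mean alpha r x
  = Rpower x (- alpha) * RInt (fun t => pow0 alpha t * r t) 0 x.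
Proof.
  intros Ha Hx Hr.
  assert (E := RInt_comp_lin (V := R_CompleteNormedModule)
    (fun t => pow0 alpha t * r t) x 0 0 1).
  rewrite Rmult_0_r, Rmult_1_r, !Rplus_0_r in E.
  rewrite <- E by (apply ex_RInt_pow0_mult; [exact Ha|lra|exact Hr]).
  clear E.
  rewrite (RInt_ext (fun y => scal x (pow0 alpha (x * y + 0) * r (x * y + 0)))
    (fun y => scal (x * Rpower x alpha) (pow0 alpha y * r (x * y)))).
  - rewrite (@RInt_scal R_CompleteNormedModule)
      by now apply ex_RInt_weighted_mean.
    change (x * weighted_mean alpha r x = Rpower x (- alpha) *
      (x * Rpower x alpha * weighted_mean alpha r x)).
    rewrite Rpower_Ropp. field. apply Rgt_not_eq, exp_pos.
  - rewrite Rmin_left, Rmax_right by lra. intros y Hy.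
    rewrite Rplus_0_r.
    change (x * (pow0 alpha (x * y) * r (x * y)) =
      x * Rpower x alpha * (pow0 alpha y * r (x * y))).
    rewrite !pow0_Rpower by nra.
    rewrite <- Rpower_mult_distr by lra. ring.
Qed.

(** The function [x * weighted_mean alpha r x] is the flux
    [x^(-alpha) * int_0^x t^alpha r(t) dt], the solution of
    [g' + alpha/x g = r] with [g 0 = 0].  Its derivative is expressed through
    the mean and is continuous up to [0]; this is what makes solutions of the
    singular equation twice differentiable there. *)
Lemma is_derive_weighted_flux alpha r x : 1 <= alpha -> 0 <= x ->
  (forall x, continuous r x) ->
  is_derive (fun x => x * weighted_mean alpha r x) x
    (r x - alpha * weighted_mean alpha r x).
Proof.
  intros Ha [Hx|<-] Hr.
  - apply (is_derive_ext_loc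
      (fun x => Rpower x (- alpha) * RInt (fun t => pow0 alpha t * r t) 0 x)).
    { apply (filter_imp (fun t => 0 < t)); [|now apply open_gt].
      intros t Ht. symmetry. now apply weighted_mean_scaling. }
    replace (r x - alpha * weighted_mean alpha r x) with
      (- alpha * Rpower x (- alpha - 1) *
         RInt (fun t => pow0 alpha t * r t) 0 x
       + Rpower x (- alpha) * (pow0 alpha x * r x)).
    + apply (is_derive_mult (fun x => Rpower x (- alpha))
        (fun x => RInt (fun t => pow0 alpha t * r t) 0 x)).
      * now apply is_derive_Rpower.
      * apply (is_derive_RInt (fun t => pow0 alpha t * r t) _ 0).
        -- apply (filter_imp (fun t => 0 < t)); [|now apply open_gt].
           intros t Ht. apply (@RInt_correct R_CompleteNormedModule).
           apply ex_RInt_pow0_mult; [exact Ha|lra|exact Hr].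
        -- apply (continuous_mult (pow0 alpha) r); [|apply Hr].
           apply continuous_pow0; lra.
      * intros. apply Rmult_comm.
    + assert (E := weighted_mean_scaling alpha r x Ha Hx Hr).
      assert (P : 0 < Rpower x alpha) by apply exp_pos.
      replace (- alpha - 1) with (- alpha + Ropp 1) by ring.
      rewrite Rpower_plus, (Rpower_Ropp x 1), Rpower_1 by exact Hx.
      rewrite (pow0_Rpower alpha x Hx).
      transitivity (- alpha * / x * (Rpower x (- alpha) *
        RInt (fun t => pow0 alpha t * r t) 0 x)
        + Rpower x (- alpha) * Rpower x alpha * r x); [ring|].
      rewrite <- E, Rpower_Ropp. field. lra.
  - replace (r 0 - alpha * weighted_mean alpha r 0)
      with (weighted_mean alpha r 0)
      by (rewrite weighted_mean_0 by exact Ha; field; lra).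
    now apply is_derive_id_mult_0, continuous_weighted_mean.
Qed.

Definition solves_linear (alpha delta eta lambda : R) (sigma z : R -> R) : Prop :=
  C2_01 z /\
  (forall x, 0 < x < 1 -> helmholtz alpha lambda z x = sigma x) /\
  flat_at_0 z /\
  z 1 = delta * z eta.

(** Variation of constants [y = phi w]: the equation becomes
    [(x^alpha phi^2 w')' = - x^alpha phi sigma], so [- phi^2 w'] is the flux of
    [phi sigma] and [w] is obtained by one more integration. *)
Lemma linear_solvable alpha delta eta lambda phi phi1 phi2
    (sigma : R -> R) :
  1 <= alpha -> regular_kernel alpha lambda phi phi1 phi2 ->
  delta * phi eta < phi 1 -> continuous_on I01 sigma ->
  exists y, solves_linear alpha delta eta lambda sigma y.
Proof.
  intros Ha (P1 & P2 & CP2 & Ppos & P10 & Pode) Hbc Hsig.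
  rewrite continuous_on_I01_clamp in Hsig.
  assert (CP : forall x, continuous phi x)
    by (intros x; eapply is_derive_continuous; apply P1).
  assert (CP1 : forall x, continuous phi1 x)
    by (intros x; eapply is_derive_continuous; apply P2).
  assert (Pne : forall x, phi x <> 0) by (intros x; apply Rgt_not_eq, Ppos).
  assert (CPi : forall x, continuous (fun t => / phi t) x)
    by (intros x; apply continuous_Rinv_comp; auto).
  set (r := fun x => phi x * sigma (clamp x)).
  assert (Cr : forall x, continuous r x).
  { intros x. apply (continuous_mult phi (fun x => sigma (clamp x))); auto. }
  set (H := weighted_mean alpha r).
  assert (CH : forall x, continuous H x) by now apply continuous_weighted_mean.
  set (g := fun x => x * H x * (/ phi x * / phi x)).
  assert (Cg : forall x, continuous g x).
  { intros x. apply (continuous_mult (fun x => x * H x)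
      (fun x => / phi x * / phi x)).
    - apply (continuous_mult (fun x => x) H); [apply continuous_id|auto].
    - apply (continuous_mult (fun x => / phi x) (fun x => / phi x)); auto. }
  set (G := fun x => RInt g 0 x).
  assert (DG : forall x, is_derive G x (g x)).
  { intros x. apply (is_derive_RInt g G 0); [|apply Cg].
    apply filter_forall. intros t.
    apply (@RInt_correct R_CompleteNormedModule).
    apply (@ex_RInt_continuous R_CompleteNormedModule). auto. }
  (* The value of [w 0] for which [phi * w] satisfies the condition at [1]. *)
  set (c := (phi 1 * G 1 - delta * (phi eta * G eta)) / (phi 1 - delta * phi eta)).
  set (w := fun x => c - G x).
  assert (Dw : forall x, is_derive w x (- g x)).
  { intros x. replace (- g x) with (0 - g x) by ring.
    apply (is_derive_minus (fun _ => c) G); [|apply DG].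
    apply @is_derive_const. }
  assert (Cw : forall x, continuous w x)
    by (intros x; eapply is_derive_continuous; apply Dw).
  set (y := fun x => phi x * w x).
  set (y1 := fun x => phi1 x * w x - x * H x / phi x).
  (* In the second derivative the terms with [phi1] cancel; what remains of
     the flux is its derivative. *)
  set (y2 := fun x => phi2 x * w x - (r x - alpha * H x) * / phi x).
  assert (Dy : forall x, is_derive y x (y1 x)).
  { intros x.
    replace (y1 x) with (phi1 x * w x + phi x * - g x)
      by (unfold y1, g; field; apply Pne).
    apply (is_derive_mult phi w); auto. intros. apply Rmult_comm. }
  assert (Dy1 : forall x, I01 x -> is_derive y1 x (y2 x)).
  { intros x Hx.
    replace (y2 x) with ((phi2 x * w x + phi1 x * - g x) -
      ((r x - alpha * H x) * phi x - x * H x * phi1 x) / phi x ^ 2)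
      by (unfold y2, g; field; apply Pne).
    apply (is_derive_minus (fun x => phi1 x * w x) (fun x => x * H x / phi x)).
    - apply (is_derive_mult phi1 w); auto. intros. apply Rmult_comm.
    - apply (is_derive_div (fun x => x * H x) phi); auto.
      apply is_derive_weighted_flux; auto. apply Hx. }
  exists y. split; [|split; [|split]].
  - apply C2_01_of_derive with (2 := Dy1); [auto|].
    apply continuous_on_I01_restrict. intros x.
    apply (continuous_minus (fun x => phi2 x * w x)
      (fun x => (r x - alpha * H x) * / phi x)).
    + apply (continuous_mult phi2 w); auto.
    + apply (continuous_mult (fun x => r x - alpha * H x) (fun x => / phi x));
        auto.
      apply (continuous_minus r (fun x => alpha * H x)); auto.
      apply (continuous_mult (fun _ => alpha) H); auto. apply continuous_const.
  - intros x Hx.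
    assert (Dy1' : forall x, 0 < x < 1 -> is_derive y1 x (y2 x))
      by (intros t Ht; apply Dy1; unfold I01; lra).
    rewrite (helmholtz_eq alpha lambda y y1 y2 x (fun t _ => Dy t) Dy1' Hx).
    assert (E : phi2 x = - lambda * phi x - alpha / x * phi1 x)
      by (rewrite <- Pode by lra; ring).
    unfold y, y1, y2, r. rewrite E, clamp_id by (unfold I01; lra).
    field. split; [apply Pne|lra].
  - assert (E : y1 0 = 0) by (unfold y1; rewrite P10; field; apply Pne).
    apply is_derive_D_in. pose proof (Dy 0) as D0. rewrite E in D0. exact D0.
  - unfold y, w, c. field. lra.
Qed.

(** * Uniform convergence *)

(** Dini's theorem.  Each point has a neighbourhood on which some term
    [g N] is already [eps]-close to [l], and later terms are then closer still.
    Taking the radius of the neighbourhood at most [1 / (N + 1)] makes the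
    common lower bound on the radii given by compactness also an upper bound on
    the indices [N]. *)
Lemma dini (g : nat -> R -> R) (l : R -> R) :
  (forall n, continuous_on I01 (g n)) -> continuous_on I01 l ->
  (forall x, I01 x -> is_lim_seq (fun n => g n x) (l x)) ->
  (forall n x, I01 x -> Rabs (g (S n) x - l x) <= Rabs (g n x - l x)) ->
  cvg_uniformly_01 g l.
Proof.
  intros Hg Hl Hlim Hdec eps Heps.
  assert (Hloc : forall x, exists d : posreal, I01 x -> exists N : nat,
    d <= / (INR N + 1) /\
    forall t, I01 t -> Rabs (t - x) < d -> Rabs (g N t - l t) < eps).
  { intros x. destruct (classic (I01 x)) as [Hx|Hx].
    2:{ exists (mkposreal 1 Rlt_0_1). intros H. contradiction. }
    assert (L := Hlim x Hx). apply is_lim_seq_spec in L.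
    destruct (L (mkposreal eps Heps)) as [N HN]. simpl in HN.
    specialize (HN N (le_n N)).
    assert (C := continuous_on_I01_minus _ _ (Hg N) Hl).
    rewrite continuous_on_I01_eps in C.
    destruct (C x Hx (eps - Rabs (g N x - l x))) as [d [Hd Hd']]; [lra|].
    assert (HN1 : 0 < / (INR N + 1)).
    { apply Rinv_0_lt_compat. pose proof (pos_INR N). lra. }
    exists (mkposreal _ (Rmin_pos _ _ Hd HN1)). intros _. exists N.
    simpl. split; [apply Rmin_r|]. intros t Ht Htx.
    specialize (Hd' t Ht (Rlt_le_trans _ _ _ Htx (Rmin_l _ _))).
    pose proof (Rabs_triang (g N t - l t - (g N x - l x)) (g N x - l x)) as T.
    replace (g N t - l t - (g N x - l x) + (g N x - l x))
      with (g N t - l t) in T by ring. lra. }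
  apply functional_choice in Hloc. destruct Hloc as [r Hr].
  destruct (compactness_value_1d 0 1 r) as [d Hd].
  destruct (nfloor_ex (/ d)) as [N [_ HN]].
  { left. apply Rinv_0_lt_compat, cond_pos. }
  exists N. intros n Hn x Hx.
  specialize (Hd x Hx). apply NNPP in Hd. destruct Hd as [t [Ht [Htx Hdt]]].
  destruct (Hr t Ht) as [m [Hm Hmt]].
  assert (Hmn : (m <= n)%nat).
  { apply Nat.le_trans with N; [|exact Hn].
    assert (INR m + 1 <= / d).
    { rewrite <- (Rinv_inv (INR m + 1)).
      apply Rinv_le_contravar; [apply cond_pos|lra]. }
    apply INR_le.
    lra. }
  apply Rle_lt_trans with (Rabs (g m x - l x)); [|now apply Hmt].
  clear - Hmn Hdec Hx. induction Hmn as [|k Hk IH]; [lra|].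
  apply Rle_trans with (2 := IH). now apply Hdec.
Qed.

Lemma cvg_uniformly_01_lim s y x : cvg_uniformly_01 s y -> I01 x ->
  is_lim_seq (fun n => s n x) (y x).
Proof.
  intros H Hx. apply is_lim_seq_spec. intros eps.
  destruct (H eps (cond_pos eps)) as [N HN]. exists N.
  intros n Hn. now apply HN.
Qed.

Lemma solves_linear_le alpha delta eta lambda sigma tau y z :
  comparison_principle alpha delta eta lambda ->
  solves_linear alpha delta eta lambda sigma y ->
  solves_linear alpha delta eta lambda tau z ->
  (forall x, 0 < x < 1 -> sigma x <= tau x) ->
  forall x, I01 x -> y x <= z x.
Proof.
  intros Hc (Hy & Ey & _ & By) (Hz & Ez & _ & Bz) Hst.
  apply Hc; try assumption; try lra.
  intros x Hx. rewrite Ey, Ez by exact Hx. now apply Hst.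
Qed.

(** If the right-hand sides differ by at most [r], comparison bounds the
    difference of the solutions by [r * e], where [e] solves the problem with
    right-hand side [1]. *)
Lemma solves_linear_stable alpha delta eta lambda sigma w (s t : nat -> R -> R) :
  comparison_principle alpha delta eta lambda ->
  (exists e, solves_linear alpha delta eta lambda (fun _ => 1) e) ->
  (forall n, solves_linear alpha delta eta lambda (s n) (t (S n))) ->
  solves_linear alpha delta eta lambda sigma w ->
  cvg_uniformly_01 s sigma -> cvg_uniformly_01 t w.
Proof.
  intros Hc [e He] Ht Hw Hs eps Heps.
  pose proof He as (Ce & Ee & _ & Be). pose proof Hw as (Cw & Ew & _ & Bw).
  destruct (continuous_on_I01_bounded e (C2_01_continuous _ Ce)) as [B [B0 HB]].
  assert (Hr : 0 < eps / (B + 1)) by (apply Rdiv_lt_0_compat; lra).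
  set (r := eps / (B + 1)) in *.
  destruct (Hs r Hr) as [N HN].
  exists (S N). intros [|n] Hn x Hx; [lia|].
  specialize (HN n ltac:(lia)).
  pose proof (Ht n) as (Ct & Et & _ & Bt).
  assert (U : t (S n) x <= 1 * w x + r * e x).
  { apply (Hc (t (S n)) (fun x => 1 * w x + r * e x)); auto.
    - now apply C2_01_lincomb.
    - intros a Ha. rewrite helmholtz_lincomb, Ew, Ee, Et by assumption.
      assert (Ia : I01 a) by (unfold I01; lra).
      specialize (HN a Ia). apply Rabs_def2 in HN. lra.
    - lra.
    - rewrite Bw, Be. right. ring. }
  assert (L : 1 * w x + (- r) * e x <= t (S n) x).
  { apply (Hc (fun x => 1 * w x + (- r) * e x) (t (S n))); auto.
    - now apply C2_01_lincomb.
    - intros a Ha. rewrite helmholtz_lincomb, Ew, Ee, Et by assumption.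
      assert (Ia : I01 a) by (unfold I01; lra).
      specialize (HN a Ia). apply Rabs_def2 in HN. lra.
    - rewrite Bw, Be. right. ring.
    - lra. }
  specialize (HB x Hx).
  assert (Q : r * Rabs (e x) < eps).
  { apply Rle_lt_trans with (r * B); [apply Rmult_le_compat_l; lra|].
    replace eps with (r * (B + 1)) by (unfold r; field; lra). nra. }
  pose proof (Rle_abs (e x)). pose proof (Rle_abs (- e x)) as Hn2.
  rewrite Rabs_Ropp in Hn2.
  apply Rabs_def1; nra.
Qed.

Lemma iterates_limit_lipschitz (s : nat -> R -> R) (u : R -> R) K :
  (forall n a b, I01 a -> I01 b ->
     Rabs (s (S n) b - s (S n) a) <= K * Rabs (b - a)) ->
  (forall x, I01 x -> is_lim_seq (fun n => s n x) (u x)) ->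
  0 <= K -> continuous_on I01 u.
Proof.
  intros HK Hl K0. apply continuous_on_I01_eps. intros x Hx eps Heps.
  assert (Hu : forall t, I01 t -> Rabs (u t - u x) <= K * Rabs (t - x)).
  { intros t Ht.
    apply (is_lim_seq_le (fun n => Rabs (s (S n) t - s (S n) x))
      (fun _ => K * Rabs (t - x)) (Rabs (u t - u x)) (K * Rabs (t - x))).
    - intros n. now apply HK.
    - apply (is_lim_seq_abs _ (Finite (u t - u x))).
      apply is_lim_seq_minus';
        apply (is_lim_seq_incr_1 (fun n => s n _)); now apply Hl.
    - apply is_lim_seq_const. }
  exists (eps / (K + 1)). split; [apply Rdiv_lt_0_compat; lra|].
  intros t Ht Htx. apply Rle_lt_trans with (1 := Hu t Ht).
  apply Rle_lt_trans with (K * (eps / (K + 1))).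
  - apply Rmult_le_compat_l; lra.
  - apply Rmult_lt_reg_r with (K + 1); [lra|].
    replace (K * (eps / (K + 1)) * (K + 1)) with (K * eps) by (field; lra). nra.
Qed.

(** * The monotone iteration *)

Definition source (f : R * R -> R) (lambda : R) (y : R -> R) (x : R) : R :=
  f (x, y x) - lambda * y x.

Lemma is_solution_fixed_point alpha delta eta lambda f y :
  is_solution alpha delta eta f y <->
  solves_linear alpha delta eta lambda (source f lambda y) y.
Proof.
  assert (E : C2_01 y -> forall x, 0 < x < 1 ->
    (Lop alpha y x = Rpower x alpha * f (x, y x) <->
     helmholtz alpha lambda y x = source f lambda y x)).
  { intros Hy x Hx. rewrite helmholtz_Lop by assumption.
    rewrite (helmholtz_shift alpha lambda). unfold source.
    assert (0 < Rpower x alpha) by apply exp_pos.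
    split; intros H0.
    - apply Rmult_eq_reg_l in H0; lra.
    - f_equal. lra. }
  split; intros (H1 & H2 & H3); (split; [exact H1|split; [|exact H3]]);
    intros x Hx; apply (E H1 x Hx); auto.
Qed.

Lemma helmholtz_ge_source alpha lambda f y x : C2_01 y -> 0 < x < 1 ->
  Lop alpha y x >= Rpower x alpha * f (x, y x) ->
  source f lambda y x <= helmholtz alpha lambda y x.
Proof.
  intros Hy Hx H. rewrite helmholtz_Lop in H by assumption.
  assert (0 < Rpower x alpha) by apply exp_pos.
  apply Rge_le, Rmult_le_reg_l in H; [|assumption].
  rewrite helmholtz_shift. unfold source. lra.
Qed.

Lemma helmholtz_le_source alpha lambda f y x : C2_01 y -> 0 < x < 1 ->
  Lop alpha y x <= Rpower x alpha * f (x, y x) ->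
  helmholtz alpha lambda y x <= source f lambda y x.
Proof.
  intros Hy Hx H. rewrite helmholtz_Lop in H by assumption.
  assert (0 < Rpower x alpha) by apply exp_pos.
  apply Rmult_le_reg_l in H; [|assumption].
  rewrite helmholtz_shift. unfold source. lra.
Qed.

Lemma source_continuous v0 u0 (f : R * R -> R) lambda (y : R -> R) :
  continuous_on (D2 v0 u0) f -> in_region v0 u0 y -> continuous_on I01 y ->
  continuous_on I01 (source f lambda y).
Proof.
  intros Hf Hr Hy.
  apply continuous_on_I01_minus; [|now apply continuous_on_I01_scal].
  intros x Hx.
  apply (filterlim_comp _ _ _ (fun x => (x, y x)) f _
    (within (D2 v0 u0) (locally (x, y x)))); [|now apply Hf, Hr].
  intros P [e He].
  specialize (Hy x Hx). apply filterlim_locally with (eps := e) in Hy.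
  destruct Hy as [d Hd].
  exists (mkposreal _ (Rmin_pos _ _ (cond_pos e) (cond_pos d))).
  intros t Ht It. change (Rabs (t - x) < Rmin e d) in Ht.
  apply He; [|now apply Hr]. split; simpl.
  - change (Rabs (t - x) < e). eapply Rlt_le_trans; [exact Ht|apply Rmin_l].
  - apply Hd; [|exact It].
    change (Rabs (t - x) < d). eapply Rlt_le_trans; [exact Ht|apply Rmin_r].
Qed.

Lemma source_lim v0 u0 (f : R * R -> R) lambda (s : nat -> R -> R) y x :
  continuous_on (D2 v0 u0) f -> (forall n, in_region v0 u0 (s n)) ->
  in_region v0 u0 y -> I01 x -> is_lim_seq (fun n => s n x) (y x) ->
  is_lim_seq (fun n => source f lambda (s n) x) (source f lambda y x).
Proof.
  intros Hf Hs Hy Hx L. apply is_lim_seq_minus'.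
  2:{ apply (is_lim_seq_scal_l _ lambda (y x) L). }
  apply (filterlim_comp _ _ _ (fun n => (x, s n x)) f _
    (within (D2 v0 u0) (locally (x, y x)))); [|now apply Hf, Hy].
  intros P [e He].
  apply is_lim_seq_spec in L. destruct (L e) as [N HN].
  exists N. intros n Hn. apply He; [|now apply Hs]. split; simpl.
  - apply ball_center.
  - exact (HN n Hn).
Qed.

Definition source_monotone (v0 u0 : R -> R) (f : R * R -> R) (lambda : R) : Prop :=
  forall y z, in_region v0 u0 y -> in_region v0 u0 z ->
  forall x, I01 x -> y x <= z x -> source f lambda y x <= source f lambda z x.

(** Subtracting [lambda * y] adds a slope [- lambda >= M3], which makes up for
    any decrease of [f]. *)
Lemma source_monotone_of_lip v0 u0 f M lambda : M + lambda <= 0 ->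
  (forall x y w, D2 v0 u0 (x, y) -> D2 v0 u0 (x, w) -> y <= w ->
     f (x, w) - f (x, y) >= - M * (w - y)) ->
  source_monotone v0 u0 f lambda.
Proof.
  intros HM Hlip y z Hy Hz x Hx Hyz. unfold source.
  specialize (Hlip x _ _ (Hy x Hx) (Hz x Hx) Hyz). nra.
Qed.

Lemma in_region_iff v0 u0 y :
  in_region v0 u0 y <-> forall x, I01 x -> v0 x <= y x <= u0 x.
Proof.
  split.
  - intros H x Hx. apply (H x Hx).
  - intros H x Hx. split; [exact Hx|now apply H].
Qed.

(** The limit is identified without passing to the limit in derivatives: the
    solution [w] of the linear problem with source at the pointwise limit [u] is
    the uniform limit of the iterates, hence equals [u] and is a fixed point. *)
Lemma monotone_iteration_converges alpha delta eta lambda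
    (f : R * R -> R) (v0 u0 : R -> R) (s : nat -> R -> R) :
  1 <= alpha ->
  comparison_principle alpha delta eta lambda ->
  (forall sigma : R -> R, continuous_on I01 sigma ->
     exists y, solves_linear alpha delta eta lambda sigma y) ->
  C2_01 u0 -> C2_01 v0 -> (forall x, I01 x -> v0 x <= u0 x) ->
  continuous_on (D2 v0 u0) f -> source_monotone v0 u0 f lambda ->
  continuous_on I01 (s 0%nat) ->
  (forall n, is_next alpha delta eta lambda f (s n) (s (S n))) ->
  (forall n, in_region v0 u0 (s n)) ->
  (forall n x, I01 x -> s (S n) x <= s n x) \/
  (forall n x, I01 x -> s n x <= s (S n) x) ->
  exists u, cvg_uniformly_01 s u /\ is_solution alpha delta eta f u /\
    in_region v0 u0 u.
Proof.
  intros Ha Hcomp Hsolv Hu0 Hv0 Hvu Hf Hmono Hs0 Hnext Hreg Hdir.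
  set (u := fun x => real (Lim_seq (fun n => s n x))).
  assert (Hlim : forall x, I01 x -> is_lim_seq (fun n => s n x) (u x)).
  { intros x Hx. apply Lim_seq_correct'. destruct Hdir as [Hd|Hd].
    - apply ex_finite_lim_seq_decr with (v0 x); auto.
      intros n. apply (Hreg n x Hx).
    - apply ex_finite_lim_seq_incr with (u0 x); auto.
      intros n. apply (Hreg n x Hx). }
  assert (Hureg : in_region v0 u0 u).
  { apply in_region_iff. intros x Hx. split.
    - apply (is_lim_seq_le (fun _ => v0 x) (fun n => s n x) (v0 x) (u x)); auto.
      + intros n. apply (Hreg n x Hx).
      + apply is_lim_seq_const.
    - apply (is_lim_seq_le (fun n => s n x) (fun _ => u0 x) (u x) (u0 x)); auto.
      + intros n. apply (Hreg n x Hx).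
      + apply is_lim_seq_const. }
  assert (Hsc : forall n, continuous_on I01 (s n)).
  { intros [|n]; [exact Hs0|]. apply C2_01_continuous, (Hnext n). }
  assert (Ru : in_region v0 u0 u0)
    by (apply in_region_iff; intros x Hx; specialize (Hvu x Hx); lra).
  assert (Rv : in_region v0 u0 v0)
    by (apply in_region_iff; intros x Hx; specialize (Hvu x Hx); lra).
  pose proof (C2_01_continuous _ Hu0) as Cu0.
  pose proof (C2_01_continuous _ Hv0) as Cv0.
  assert (Hlip : exists K, 0 <= K /\ forall n a b, I01 a -> I01 b ->
    Rabs (s (S n) b - s (S n) a) <= K * Rabs (b - a)).
  { destruct (continuous_on_I01_bounded _
      (source_continuous v0 u0 f lambda u0 Hf Ru Cu0)) as [B1 [B1p HB1]].
    destruct (continuous_on_I01_bounded _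
      (source_continuous v0 u0 f lambda v0 Hf Rv Cv0)) as [B2 [B2p HB2]].
    destruct (continuous_on_I01_bounded _ Cu0) as [B3 [B3p HB3]].
    destruct (continuous_on_I01_bounded _ Cv0) as [B4 [B4p HB4]].
    (* By monotonicity the source along the iterates lies between its values
       at [v0] and at [u0]. *)
    exists (B1 + B2 + Rabs lambda * (B3 + B4)).
    pose proof (Rabs_pos lambda) as Lp.
    split; [nra|].
    intros n. destruct (Hnext n) as (C & E & _).
    apply equi_lipschitz with alpha; [exact Ha|exact C|].
    intros x Hx. assert (Ix : I01 x) by (unfold I01; lra).
    specialize (E x Hx).
    change (helmholtz alpha lambda (s (S n)) x = source f lambda (s n) x) in E.
    rewrite helmholtz_shift in E.
    replace (helmholtz alpha 0 (s (S n)) x)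
      with (source f lambda (s n) x + lambda * s (S n) x) by lra.
    eapply Rle_trans; [apply Rabs_triang|]. rewrite Rabs_mult.
    pose proof (Hreg n x Ix) as [_ [V1 V2]].
    pose proof (Hreg (S n) x Ix) as [_ [W1 W2]].
    cbn [fst snd] in V1, V2, W1, W2.
    pose proof (Hmono _ _ Rv (Hreg n) x Ix V1) as S1.
    pose proof (Hmono _ _ (Hreg n) Ru x Ix V2) as S2.
    specialize (HB1 x Ix). specialize (HB2 x Ix).
    specialize (HB3 x Ix). specialize (HB4 x Ix).
    apply Rplus_le_compat.
    - revert HB1 HB2. unfold Rabs. repeat destruct Rcase_abs; lra.
    - apply Rmult_le_compat_l; [exact Lp|].
      revert HB3 HB4. unfold Rabs. repeat destruct Rcase_abs; lra. }
  destruct Hlip as [K [K0 HK]].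
  assert (Cu : continuous_on I01 u)
    by (apply iterates_limit_lipschitz with s K; assumption).
  pose proof (source_continuous v0 u0 f lambda u Hf Hureg Cu) as Csu.
  (* Monotonicity of the source makes its distance to the limit decrease. *)
  assert (Usrc : cvg_uniformly_01 (fun n => source f lambda (s n))
                   (source f lambda u)).
  { apply dini.
    - intros n. now apply (source_continuous v0 u0).
    - exact Csu.
    - intros x Hx. apply (source_lim v0 u0); auto.
    - intros n x Hx. destruct Hdir as [Hd|Hd].
      + assert (B : u x <= s (S n) x).
        { apply (is_lim_seq_decr_compare (fun n => s n x) (u x)); auto. }
        pose proof (Hmono _ _ Hureg (Hreg (S n)) x Hx B).
        pose proof (Hmono _ _ (Hreg (S n)) (Hreg n) x Hx (Hd n x Hx)).
        rewrite !Rabs_pos_eq by lra. lra.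
      + assert (B : s (S n) x <= u x).
        { apply (is_lim_seq_incr_compare (fun n => s n x) (u x)); auto. }
        pose proof (Hmono _ _ (Hreg (S n)) Hureg x Hx B).
        pose proof (Hmono _ _ (Hreg n) (Hreg (S n)) x Hx (Hd n x Hx)).
        rewrite !Rabs_left1 by lra. lra. }
  destruct (Hsolv _ Csu) as [w Hw].
  assert (Uw : cvg_uniformly_01 s w).
  { apply (solves_linear_stable alpha delta eta lambda (source f lambda u) w
      (fun n => source f lambda (s n)) s); auto.
    apply Hsolv, continuous_on_I01_restrict. intros x. apply continuous_const. }
  assert (Euw : forall x, I01 x -> u x = w x).
  { intros x Hx. pose proof (cvg_uniformly_01_lim s w x Uw Hx) as L.
    apply is_lim_seq_unique in L. unfold u. now rewrite L. }
  exists w. split; [exact Uw|]. split.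
  - apply (is_solution_fixed_point alpha delta eta lambda).
    destruct Hw as (H1 & H2 & H3). split; [exact H1|]. split; [|exact H3].
    intros x Hx. rewrite H2 by exact Hx. unfold source.
    rewrite Euw by (unfold I01; lra). reflexivity.
  - apply in_region_iff. intros x Hx. rewrite <- Euw by exact Hx.
    exact (proj1 (in_region_iff v0 u0 u) Hureg x Hx).
Qed.

(** Existence iterates a choice of solutions of the linear problem; uniqueness
    on [[0,1]] is comparison applied in both directions at each step. *)
Lemma generated_exists alpha delta eta lambda (f : R * R -> R) (v0 u0 y0 : R -> R) :
  comparison_principle alpha delta eta lambda ->
  (forall sigma : R -> R, continuous_on I01 sigma ->
     exists y, solves_linear alpha delta eta lambda sigma y) ->
  continuous_on (D2 v0 u0) f ->
  (forall y z, in_region v0 u0 y -> is_next alpha delta eta lambda f y z ->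
     in_region v0 u0 z) ->
  in_region v0 u0 y0 -> continuous_on I01 y0 ->
  exists s, generated alpha delta eta lambda f v0 u0 y0 s /\ s 0%nat = y0.
Proof.
  intros Hc Hsolv Hf Hinv R0 C0.
  assert (Hop : exists L : (R -> R) -> (R -> R), forall sigma,
    continuous_on I01 sigma ->
    solves_linear alpha delta eta lambda sigma (L sigma)).
  { apply (functional_choice (fun (sigma y : R -> R) =>
      continuous_on I01 sigma -> solves_linear alpha delta eta lambda sigma y)).
    intros sigma. destruct (classic (continuous_on I01 sigma)) as [H|H].
    - destruct (Hsolv sigma H) as [y Hy]. now exists y.
    - (* An arbitrary value where nothing is required. *)
      exists sigma. intros H'. contradiction. }
  destruct Hop as [L HL].
  set (s := fun n => Nat.iter n (fun y => L (source f lambda y)) y0).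
  assert (Hs : forall n, in_region v0 u0 (s n) /\ continuous_on I01 (s n)).
  { induction n as [|n [IR IC]]; [now split|].
    assert (Hn : is_next alpha delta eta lambda f (s n) (s (S n)))
      by (apply (HL (source f lambda (s n))); now apply (source_continuous v0 u0)).
    split; [now apply (Hinv (s n))|]. apply C2_01_continuous, Hn. }
  assert (Hnext : forall n, is_next alpha delta eta lambda f (s n) (s (S n))).
  { intros n. apply HL, (source_continuous v0 u0); [exact Hf| |]; apply Hs. }
  exists s. split; [|reflexivity]. split; [|split].
  - split; [reflexivity|exact Hnext].
  - intros n. apply Hs.
  - intros s' [H0 Hn'] n. induction n as [|n IH]; [exact H0|].
    intros x Hx.
    assert (E : forall t, 0 < t < 1 ->
      source f lambda (s' n) t = source f lambda (s n) t).
    { intros t Ht. unfold source. rewrite IH by (unfold I01; lra). reflexivity. }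
    apply Rle_antisym.
    + apply (solves_linear_le alpha delta eta lambda _ _ _ _ Hc (Hn' n) (Hnext n));
        [|exact Hx].
      intros t Ht. right. now apply E.
    + apply (solves_linear_le alpha delta eta lambda _ _ _ _ Hc (Hnext n) (Hn' n));
        [|exact Hx].
      intros t Ht. right. symmetry. now apply E.
Qed.

Theorem theorem5p3 (alpha delta eta nu : R)
  (halpha : 1 <= alpha) (hdelta : 0 < delta) (heta : 0 < eta < 1)
  (hnu : nu = (1 - alpha) / 2)
  (u0 v0 : R -> R) (f : R * R -> R)
  (hu0 : C2_01 u0) (hv0 : C2_01 v0)
  (hvu : forall x, I01 x -> v0 x <= u0 x)
  (hu0_ode : forall x, 0 < x < 1 -> Lop alpha u0 x >= Rpower x alpha * f (x, u0 x))
  (hu0_0 : flat_at_0 u0) (hu0_1 : u0 1 >= delta * u0 eta)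
  (hv0_ode : forall x, 0 < x < 1 -> Lop alpha v0 x <= Rpower x alpha * f (x, v0 x))
  (hv0_0 : flat_at_0 v0) (hv0_1 : v0 1 <= delta * v0 eta)
  (hf : continuous_on (D2 v0 u0) f)
  (M3 : R) (hM3 : 0 <= M3)
  (hlip : forall x y w, D2 v0 u0 (x, y) -> D2 v0 u0 (x, w) -> y <= w ->
     f (x, w) - f (x, y) >= - M3 * (w - y))
  (lambda : R) (hlambda : lambda < 0) (hMlambda : M3 + lambda <= 0)
  (hK : besselK nu (sqrt (Rabs lambda))
        - delta * Rpower eta nu * besselK nu (eta * sqrt (Rabs lambda)) <= 0)
  (hI : besselI (- nu) (sqrt (Rabs lambda))
        - delta * Rpower eta nu * besselI (- nu) (eta * sqrt (Rabs lambda)) > 0) :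
  (exists y, is_solution alpha delta eta f y /\ in_region v0 u0 y) /\
  exists (us vs : nat -> R -> R) (u v : R -> R),
    (generated alpha delta eta lambda f v0 u0 u0 us /\
     (forall n x, I01 x -> us (S n) x <= us n x) /\
     cvg_uniformly_01 us u /\
     is_solution alpha delta eta f u /\ in_region v0 u0 u) /\
    (generated alpha delta eta lambda f v0 u0 v0 vs /\
     (forall n x, I01 x -> vs n x <= vs (S n) x) /\
     cvg_uniformly_01 vs v /\
     is_solution alpha delta eta f v /\ in_region v0 u0 v) /\
    (forall z, is_solution alpha delta eta f z -> in_region v0 u0 z ->
       forall x, I01 x -> v x <= z x <= u x).
Proof.
  pose proof (bessel_boundary_sign alpha delta eta nu lambda halpha heta hnu
                hlambda hI) as Hsign.
  destruct (bessel_kernel alpha lambda halpha hlambda) as (phi1 & phi2 & Hphi).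
  set (phi := fun x => PSeries (bessel_coef ((alpha - 1) / 2)) (- lambda / 4 * x ^ 2))
    in *.
  change (delta * phi eta < phi 1) in Hsign.
  pose proof (fun sigma => linear_solvable alpha delta eta lambda phi phi1 phi2
                sigma halpha Hphi Hsign) as Hsolv.
  assert (Hcomp : comparison_principle alpha delta eta lambda).
  { destruct Hphi as (P1 & P2 & CP2 & Ppos & _ & Pode).
    apply comparison_of_positive_kernel with phi; auto.
    - apply C2_01_of_derive with phi1 phi2; auto.
      now apply continuous_on_I01_restrict.
    - intros x Hx.
      rewrite (helmholtz_eq alpha lambda phi phi1 phi2) by auto.
      pose proof (Pode x ltac:(lra)). lra. }
  pose proof (source_monotone_of_lip v0 u0 f M3 lambda hMlambda hlip) as Hmono.
  assert (Ru : in_region v0 u0 u0)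
    by (apply in_region_iff; intros x Hx; specialize (hvu x Hx); lra).
  assert (Rv : in_region v0 u0 v0)
    by (apply in_region_iff; intros x Hx; specialize (hvu x Hx); lra).
  assert (Hle : forall y z Y Z, in_region v0 u0 y -> in_region v0 u0 z ->
    is_next alpha delta eta lambda f y Y -> is_next alpha delta eta lambda f z Z ->
    (forall x, I01 x -> y x <= z x) -> forall x, I01 x -> Y x <= Z x).
  { intros y z Y Z Hy Hz HY HZ Hyz.
    apply (solves_linear_le alpha delta eta lambda _ _ _ _ Hcomp HY HZ).
    intros x Hx. assert (I01 x) by (unfold I01; lra). now apply Hmono; auto. }
  assert (Hinv : forall y z, in_region v0 u0 y ->
    is_next alpha delta eta lambda f y z -> in_region v0 u0 z).
  { intros y z Hy (Cz & Ez & _ & Bz). apply in_region_iff. intros x Hx.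
    split; revert x Hx; apply Hcomp; auto; try lra; intros x Hx;
      assert (Ix : I01 x) by (unfold I01; lra);
      assert (E : helmholtz alpha lambda z x = source f lambda y x)
        by exact (Ez x Hx);
      rewrite E; destruct (proj1 (in_region_iff v0 u0 y) Hy x Ix) as [V1 V2].
    - apply Rle_trans with
        (1 := helmholtz_le_source _ lambda _ _ _ hv0 Hx (hv0_ode x Hx)).
      now apply Hmono.
    - apply Rle_trans with
        (2 := helmholtz_ge_source _ lambda _ _ _ hu0 Hx (hu0_ode x Hx)).
      now apply Hmono. }
  destruct (generated_exists alpha delta eta lambda f v0 u0 u0 Hcomp Hsolv hf Hinv
    Ru (C2_01_continuous _ hu0)) as (us & Gu & Eu).
  destruct (generated_exists alpha delta eta lambda f v0 u0 v0 Hcomp Hsolv hf Hinv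
    Rv (C2_01_continuous _ hv0)) as (vs & Gv & Ev).
  pose proof Gu as ((_ & Nu) & Iu & _). pose proof Gv as ((_ & Nv) & Iv & _).
  assert (Mu : forall n x, I01 x -> us (S n) x <= us n x).
  { induction n as [|n IH].
    - rewrite Eu. apply in_region_iff with (1 := Iu 1%nat).
    - apply (Hle (us (S n)) (us n)); auto. }
  assert (Mv : forall n x, I01 x -> vs n x <= vs (S n) x).
  { induction n as [|n IH].
    - rewrite Ev. apply in_region_iff with (1 := Iv 1%nat).
    - apply (Hle (vs n) (vs (S n))); auto. }
  destruct (monotone_iteration_converges alpha delta eta lambda f v0 u0 us)
    as (u & Uu & Su & Du); auto.
  { rewrite Eu. now apply C2_01_continuous. }
  destruct (monotone_iteration_converges alpha delta eta lambda f v0 u0 vs)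
    as (v & Uv & Sv & Dv); auto.
  { rewrite Ev. now apply C2_01_continuous. }
  split; [now exists u|].
  exists us, vs, u, v.
  split; [exact (conj Gu (conj Mu (conj Uu (conj Su Du))))|].
  split; [exact (conj Gv (conj Mv (conj Uv (conj Sv Dv))))|].
  intros z Hz Rz.
  apply (is_solution_fixed_point alpha delta eta lambda) in Hz.
  pose proof (proj1 (in_region_iff v0 u0 z) Rz) as Bz.
  assert (Zu : forall n x, I01 x -> z x <= us n x).
  { induction n as [|n IH].
    - rewrite Eu. intros x Hx. now apply Bz.
    - apply (Hle z (us n)); auto. }
  assert (Zv : forall n x, I01 x -> vs n x <= z x).
  { induction n as [|n IH].
    - rewrite Ev. intros x Hx. now apply Bz.
    - apply (Hle (vs n) z); auto. }
  intros x Hx. split.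
  - apply (is_lim_seq_le (fun n => vs n x) (fun _ => z x) (v x) (z x)); auto.
    + now apply cvg_uniformly_01_lim.
    + apply is_lim_seq_const.
  - apply (is_lim_seq_le (fun _ => z x) (fun n => us n x) (z x) (u x)); auto.
    + apply is_lim_seq_const.
    + now apply cvg_uniformly_01_lim.
Qed.
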